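(* Let $n\ge 1$ be an integer. For every $k=n-1,n-2,\ldots,2$, one has $$\operatorname{Sing}Z_k=Z_{k-1}.$$ Equivalently, for every $k=1,\ldots,n-1$, $$Z_k=\underbrace{\operatorname{Sing}\cdots\operatorname{Sing}}_{n-1-k\text{ iterations}}\,V(D).$$ Hence $Z_{n-1}\supsetneq Z_{n-2}\supsetneq\cdots\supsetneq Z_1$ is the smoothness-based stratification of the discriminant hypersurface $Z_{n-1}=V(D)$ (that is, the strictly decreasing chain obtained from $V(D)$ by recursively removing all smooth points, ending with the smooth variety $Z_1$).
   Context: Let $F=x^n+a_{n-1}x^{n-1}+\cdots+a_1x+a_0$ be the general monic univariate polynomial of degree $n$, with indeterminate coefficients $a_0,\ldots,a_{n-1}$, and let $D\in\mathbb{C}[a_0,\ldots,a_{n-1}]$ be its discriminant with respect to $x$, i.e. $D=(-1)^{n(n-1)/2}\operatorname{res}_x(F,F')$ with $F'=\partial F/\partial x$. A point $\gamma=(\gamma_0,\ldots,\gamma_{n-1})\in\mathbb{C}^n$ is identified with the polynomial $F_\gamma=x^n+\gamma_{n-1}x^{n-1}+\cdots+\gamma_0$. For an integer $k\ge 0$, $$Z_k=\{\gamma\in\mathbb{C}^n : F_\gamma \text{ has at most } k \text{ distinct complex roots}\},$$ which is an algebraic subset of $\mathbb{C}^n$. $V(D)\subseteq\mathbb{C}^n$ is the zero set of $D$. Varieties are (possibly reducible) algebraic subsets of $\mathbb{C}^n$ with their reduced structure, and $\operatorname{Sing}W$ denotes the singular locus (the set of singular points) of the variety $W$. *)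

(* Defs.v *)
From HB Require Import structures.
From mathcomp Require Import all_boot all_order all_algebra.
From mathcomp Require Import classical_sets reals.
From mathcomp Require Import complex mpoly.

Set Implicit Arguments.
Unset Strict Implicit.
Unset Printing Implicit Defensive.

Import GRing.Theory.
Local Open Scope ring_scope.
Local Open Scope classical_set_scope.

Section AffineVarieties.
Variables (K : closedFieldType) (n : nat).
Implicit Types (W X Y : set 'rV[K]_n) (p v : 'rV[K]_n).

Definition zero_locus (E : set {mpoly K[n]}) : set 'rV[K]_n :=
  [set p | forall f, E f -> f.@[p 0] = 0].

Definition vanishing_ideal W : set {mpoly K[n]} :=
  [set f | forall p, W p -> f.@[p 0] = 0].

Definition algebraic W : Prop :=
  exists E : set {mpoly K[n]}, W = zero_locus E.

(* The irreducible closed subsets of the affine space. *)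
Definition irreducible_closed X : Prop :=
  [/\ algebraic X, X !=set0 &
      forall A B, algebraic A -> algebraic B -> X = A `|` B ->
        X = A \/ X = B].

(* X 0 `<` X 1 `<` ... `<` X d; such chains correspond to the chains of
   primes of length d in the local ring of W at p. *)
Definition chain_at W p (d : nat) : Prop :=
  exists X : nat -> set 'rV[K]_n,
    (forall i, (i <= d)%N ->
       [/\ irreducible_closed (X i), X i p & X i `<=` W]) /\
    (forall i, (i < d)%N -> X i `<` X i.+1).

(* d is the Krull dimension of the local ring of W at p. *)
Definition local_dim W p (d : nat) : Prop :=
  chain_at W p d /\ forall e, chain_at W p e -> (e <= d)%N.

(* The Zariski tangent space of W with its reduced structure: the
   differentials of all polynomials of the vanishing ideal are used, not only
   those of some set of equations defining W. *)
Definition tangent_space W p : set 'rV[K]_n :=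
  [set v | forall f, vanishing_ideal W f ->
     \sum_(i < n) f^`M(i).@[p 0] * v 0 i = 0].

Definition tangent_dim W p (d : nat) : Prop :=
  exists B : 'M[K]_(d, n),
    row_free B /\ forall v, tangent_space W p v <-> (v <= B)%MS.

(* Regularity of the local ring; W may be reducible and its components may
   have different dimensions, whence the local dimension. *)
Definition smooth_point W p : Prop :=
  W p /\ exists d, tangent_dim W p d /\ local_dim W p d.

Definition Sing W : set 'rV[K]_n := [set p | W p /\ ~ smooth_point W p].

(* s lists the strata W, Sing W, Sing (Sing W), ... down to the first smooth
   one, whose singular locus is empty; the empty variety has no stratum. *)
Fixpoint smoothness_stratification W (s : seq (set 'rV[K]_n)) : Prop :=
  if s is V :: s' then
    [/\ V = W, Sing W `<` W & smoothness_stratification (Sing W) s']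
  else W = set0.

End AffineVarieties.

Definition monic_poly_of (A : comNzRingType) (n : nat) (c : 'I_n -> A) :
    {poly A} :=
  'X^n + \sum_(i < n) c i *: 'X^i.

Section Discriminant.
Variables (K : closedFieldType) (n : nat).

Definition generic_poly : {poly {mpoly K[n]}} :=
  monic_poly_of (fun i : 'I_n => 'X_i : {mpoly K[n]}).

Definition discriminant : {mpoly K[n]} :=
  (-1) ^+ (n * n.-1)./2 * resultant generic_poly generic_poly^`().

Definition VD : set 'rV[K]_n := zero_locus [set discriminant].

Definition Z (k : nat) : set 'rV[K]_n :=
  [set g | forall s : seq K,
     uniq s -> all (root (monic_poly_of (g 0))) s -> (size s <= k)%N].

End Discriminant.

Arguments VD : clear implicits.
Arguments Z : clear implicits.

(* Main.v *)
Require Import Defs.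
From HB Require Import structures.
From mathcomp Require Import all_boot all_order all_algebra.
From mathcomp Require Import boolp classical_sets reals.
From mathcomp Require Import complex mpoly ring.

(** Everything is proved over an algebraically closed field K of
    characteristic 0. A point g of Z_k is compared with the factorization
    F = \prod_a ('X - s_a)^(m_a) of its polynomial into l distinct roots; the
    three polynomials Q = gcd(F, F') = \prod_a ('X - s_a)^(m_a - 1),
    P = \prod_a ('X - s_a) and L = F' / Q govern all the computations.

    Equations. The polynomial F has at most k distinct roots exactly when
    A F + B F' = 0 has a solution (A, B) <> 0 with deg A < k and deg B <= k,
    since such a B vanishes at all the roots of F ([syl_row_freeP], [Z_syl]).
    So Z_k is the locus where a matrix of Sylvester type, with entries affine in
    the point, is not of full rank.

    Smoothness at a point with exactly k roots. There the syzygies (A, B) form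
    the line spanned by (-L, P), so the matrix has corank 1 and
    differentiating its maximal minors in a tangent direction v gives that
    P v' - L v is a combination of F and F', hence a multiple of Q. Comparing
    orders of vanishing at each root forces Q to divide v
    ([rgcd_dvd_wronskian]), which leaves a space of dimension k; it is filled by
    the velocities F / ('X - s_a) of the moving roots ([tangent_dim_distinct]).
    The local dimension is also k. Freeing the roots one at a time gives a chain
    of k + 1 irreducible closed sets ([chain_at_distinct]). Conversely, a chain
    X_0 < ... < X_{k+1} in Z_k would give k + 1 functions f_i, vanishing on
    X_i but not on X_{i+1}, that are algebraically independent on X_{k+1}
    ([chain_independent]), whereas the points of Z_k are parametrized by their
    k roots and k + 1 polynomials in k variables are algebraically dependent
    ([algebraic_dependence]).

    Singularity at a point with fewer roots. Every chain in Z_k has length at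
    most k, so it suffices that the tangent space has dimension above k. At a
    point with exactly k - 1 <= n - 2 roots, besides the k - 1 velocities
    F / ('X - s_a), the curve obtained by splitting a root of multiplicity
    N + 1, placed at the origin, as ('X - t)^N ('X + N t) has the tangents
    F / ('X - s_r)^2 and, when N >= 2, F / ('X - s_r)^3. A root of multiplicity
    at least 3, or else two double roots, thus give k + 1 independent tangents
    ([extra_tangents]). Any point with fewer roots is the limit, along a
    polynomial curve, of points with exactly k - 1 roots, and the dimension of
    the tangent space cannot drop in the limit ([tangent_semicontinuous]). This
    gives Sing Z_k = Z_{k-1} ([Sing_Z]).

    Finally the discriminant vanishes exactly when F and F' have a common root,
    that is when F has at most n - 1 distinct roots ([Z_VD]), and the remaining
    claims follow by induction. *)

Set Implicit Arguments.
Unset Strict Implicit.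
Unset Printing Implicit Defensive.

Import GRing.Theory.
Local Open Scope ring_scope.
Local Open Scope classical_set_scope.

(** * Points of affine space as monic polynomials *)

Lemma rVpolyE (A : comNzRingType) d (v : 'rV[A]_d) :
  rVpoly v = \sum_(i < d) v 0 i *: 'X^i.
Proof.
apply/polyP => j; rewrite coef_sum coef_rVpoly; case: insubP => [i _ <-|].
  rewrite (bigD1 i) //= coefZ coefXn eqxx mulr1 big1 ?addr0 // => k /eqP ki.
  by rewrite coefZ coefXn; case: eqP => [/val_inj/esym|_]; rewrite ?mulr0.
rewrite -leqNgt => nj; rewrite big1 // => i _; rewrite coefZ coefXn.
by case: eqP => [jE|]; rewrite ?mulr0 //; move: (ltn_ord i); rewrite -jE ltnNge nj.
Qed.

Lemma size_monic_poly_of (A : comNzRingType) n (c : 'I_n -> A) :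
  size (monic_poly_of c) = n.+1.
Proof.
rewrite /monic_poly_of size_polyDl size_polyXn // ltnS.
apply: (leq_trans (size_sum _ _ _)); apply/bigmax_leqP => i _.
by rewrite (leq_trans (size_scale_leq _ _)) // size_polyXn.
Qed.

Section Points.
Variables (K : fieldType) (n : nat).
Implicit Types (g : 'rV[K]_n) (p : {poly K}).

Lemma monic_poly_ofE g : monic_poly_of (g 0) = 'X^n + rVpoly g.
Proof. by rewrite rVpolyE. Qed.

Lemma poly_rV_monic_poly_of g : poly_rV (monic_poly_of (g 0)) = g.
Proof.
apply/rowP => i; rewrite monic_poly_ofE mxE coefD coefXn coef_rVpoly_ord.
by rewrite ltn_eqF ?add0r.
Qed.

Lemma monic_poly_of_monic g : monic_poly_of (g 0) \is monic.
Proof.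
rewrite monic_poly_ofE monicE lead_coefDl ?lead_coefXn //.
by rewrite size_polyXn ltnS size_poly.
Qed.

Lemma monic_poly_of_poly_rV p : p \is monic -> size p = n.+1 ->
  monic_poly_of ((poly_rV p : 'rV_n) 0) = p.
Proof.
move=> pm sp; rewrite monic_poly_ofE; apply/polyP => j.
rewrite coefD coefXn; have [->|jn] := eqVneq j n.
  rewrite nth_default ?addr0 ?size_poly //.
  by move: pm; rewrite monicE lead_coefE sp => /eqP.
rewrite add0r coef_rVpoly; case: insubP => [i _ <-|]; first by rewrite mxE.
by rewrite -leqNgt => nj; rewrite nth_default // sp ltn_neqAle eq_sym jn.
Qed.

End Points.

(** * Polynomial curves and tangent vectors *)

Section Curves.
Variables (K : fieldType) (n : nat).
Implicit Types (f : {mpoly K[n]}) (q : 'I_n -> {poly K}).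

(** Unlike the monomial induction principle, this one follows the ring
    operations, as suits identities between ring morphisms and derivations. *)
Lemma mpoly_ring_ind (P : {mpoly K[n]} -> Prop) :
  (forall c, P c%:MP) -> (forall i, P 'X_i) ->
  (forall f g, P f -> P g -> P (f + g)) ->
  (forall f g, P f -> P g -> P (f * g)) -> forall f, P f.
Proof.
move=> PC PX PD PM; apply: mpolyind => [|c m f _ _ Pf]; first exact: PC.
apply: PD => //; rewrite -mul_mpolyC; apply: (PM) => //; rewrite // mpolyXE_id.
apply: (big_ind P) => [|f1 f2|i _]; first by rewrite -mpolyC1.
  exact: PM.
by elim: (m i) => [|j Pj]; rewrite ?expr0 ?exprS -?mpolyC1 //; apply: (PM).
Qed.

Lemma mmapXU q i : mmap polyC q 'X_i = q i.
Proof. by rewrite mmapX mmap1U. Qed.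

Lemma horner_mmap q f t :
  (mmap polyC q f).[t] = f.@[fun i => (q i).[t]].
Proof.
elim/mpoly_ring_ind: f => [c|i|f g Pf Pg|f g Pf Pg].
- by rewrite mmapC hornerC mevalC.
- by rewrite mmapXU mevalXU.
- by rewrite !raddfD /= hornerD Pf Pg.
- by rewrite !rmorphM /= hornerM Pf Pg.
Qed.

(** The chain rule along the polynomial curve q. *)
Lemma deriv_mmap q f : (mmap polyC q f)^`() =
  \sum_(i < n) mmap polyC q f^`M(i) * (q i)^`().
Proof.
elim/mpoly_ring_ind: f => [c|i|f g Pf Pg|f g Pf Pg].
- by rewrite mmapC derivC big1 // => i _; rewrite mderivC raddf0 mul0r.
- rewrite mmapXU (bigD1 i) //= mderivX mnm1E eqxx scale1r.
  have -> : (U_(i) - U_(i) = 0 :> 'X_{1..n})%MM.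
    by apply/mnmP => j; rewrite mnmBE subnn mnm0E.
  rewrite mmapX mmap11 mul1r big1 ?addr0 // => j /negbTE ji.
  by rewrite mderivX mnm1E eq_sym ji scale0r raddf0 mul0r.
- rewrite raddfD /= derivD Pf Pg -big_split /=; apply: eq_bigr => i _.
  by rewrite mderivD raddfD mulrDl.
- rewrite rmorphM /= derivM Pf Pg mulr_suml mulr_sumr -big_split /=.
  apply: eq_bigr => i _; rewrite mderivM raddfD /= !rmorphM /= mulrDl.
  by rewrite mulrAC -!mulrA; congr (_ + _); rewrite mulrCA mulrA mulrC -!mulrA.
Qed.

End Curves.

Section CharacteristicZero.
Variable K : fieldType.
Hypothesis char0 : forall j : nat, j.+1%:R != 0 :> K.

Lemma natr_inj0 : injective (fun j : nat => j%:R : K).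
Proof.
move=> a b /= ab; wlog lt_ab : a b ab / (a < b)%N => [H|].
  by case: (ltngtP a b) => // lt_ab; [exact: H|apply/esym; exact: H].
have := char0 (b - a.+1); rewrite -subSn // subSS natrB 1?ltnW //.
by rewrite ab subrr eqxx.
Qed.

Lemma exists_nonroot (p : {poly K}) : p != 0 -> exists t, p.[t] != 0.
Proof.
move=> p0; apply: contrapT => H.
have: (size [seq j%:R : K | j <- iota 0 (size p)] < size p)%N.
  apply: max_poly_roots => //.
    apply/allP => t _; apply/eqP; apply: contrapT => pt.
    by apply: H; exists t; apply/eqP.
  by rewrite map_inj_uniq ?iota_uniq //; exact: natr_inj0.
by rewrite size_map size_iota ltnn.
Qed.

Lemma poly_fun_eq0 (p : {poly K}) : (forall t, p.[t] = 0) -> p = 0.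
Proof.
move=> H; apply/eqP; apply: contrapT => /negP/exists_nonroot[t].
by rewrite H eqxx.
Qed.

End CharacteristicZero.

Section CurveTangent.
Variables (K : closedFieldType) (n : nat).
Hypothesis char0 : forall j : nat, j.+1%:R != 0 :> K.
Implicit Types (f : {mpoly K[n]}) (Phi : {poly {poly K}}) (W : set 'rV[K]_n).

(** A curve in the space of polynomials is given by Phi in K['X]['X] whose outer
    variable is the parameter t; its velocity and higher coefficients are then
    just the coefficients of Phi. *)
Definition curve_coord Phi (i : 'I_n) : {poly K} := map_poly (coefp i) Phi.

Lemma coef_coord Phi i j : (curve_coord Phi i)`_j = (Phi`_j)`_i.
Proof. by rewrite coef_map. Qed.

Lemma horner_coord Phi i t : (curve_coord Phi i).[t] = (Phi.[t%:P])`_i.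
Proof.
rewrite [Phi.[_]]horner_coef coef_sum (@horner_coef_wide _ (size Phi)).
  by apply: eq_bigr => j _; rewrite coef_coord -polyC_exp coefMC.
exact: size_poly.
Qed.

Lemma meval_curve f Phi t :
  f.@[(poly_rV Phi.[t%:P] : 'rV_n) 0] = (mmap polyC (curve_coord Phi) f).[t].
Proof.
by rewrite horner_mmap; apply: meval_eq => i; rewrite mxE horner_coord.
Qed.

Lemma vanishing_curve f W Phi : (forall t, W (poly_rV Phi.[t%:P])) ->
  vanishing_ideal W f -> mmap polyC (curve_coord Phi) f = 0.
Proof.
move=> HW Hf; apply: poly_fun_eq0 => // t.
by rewrite -meval_curve; apply: Hf.
Qed.

Lemma meval_curve0 f Phi :
  f.@[(poly_rV Phi`_0 : 'rV_n) 0] = (mmap polyC (curve_coord Phi) f)`_0.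
Proof. by rewrite -!horner_coef0 -meval_curve polyC0. Qed.

Lemma vanishing_curve_deriv f W Phi : (forall t, W (poly_rV Phi.[t%:P])) ->
  vanishing_ideal W f -> \sum_(i < n)
    mmap polyC (curve_coord Phi) f^`M(i) * (curve_coord Phi i)^`() = 0.
Proof.
by move=> HW Hf; rewrite -deriv_mmap (vanishing_curve HW Hf) deriv0.
Qed.

(** The first-order term, in the parameter, of f evaluated along the curve. *)
Lemma tangent_curve W Phi : (forall t, W (poly_rV Phi.[t%:P])) ->
  tangent_space W (poly_rV Phi`_0) (poly_rV Phi`_1).
Proof.
move=> HW f Hf; have := congr1 (fun p : {poly K} => p`_0) (vanishing_curve_deriv HW Hf).
rewrite coef0 coef_sum => H; rewrite -[RHS]H; apply: eq_bigr => i _.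
by rewrite coef0M coef_deriv mulr1n coef_coord mxE meval_curve0.
Qed.

(** When the velocity vanishes, the quadratic part of f only contributes from
    the parameter order 4 on, so that the orders 2 and 3 still see nothing but
    the differential of f. *)
Lemma tangent_cusp W Phi : (forall t, W (poly_rV Phi.[t%:P])) -> Phi`_1 = 0 ->
  tangent_space W (poly_rV Phi`_0) (poly_rV Phi`_2) /\
  tangent_space W (poly_rV Phi`_0) (poly_rV Phi`_3).
Proof.
move=> HW Phi1; split=> f Hf; have H := vanishing_curve_deriv HW Hf.
  apply: (mulfI (char0 1)); rewrite mulr0.
  have := congr1 (fun p : {poly K} => p`_1) H; rewrite coef0 coef_sum => {}H.
  rewrite -[RHS]H mulr_sumr; apply: eq_bigr => i _.
  rewrite coefM big_ord_recl big_ord1 /= subn0 subnn /bump /=.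
  rewrite !coef_deriv !coef_coord Phi1 coef0 mulr1n mulr0 addr0.
  by rewrite mulrC -mulrA -meval_curve0 mxE mulr_natr.
(* The partial derivatives of f are constant to first order along the curve. *)
have d1 i : (mmap polyC (curve_coord Phi) f^`M(i))`_1 = 0.
  rewrite -[LHS]mulr1n -coef_deriv deriv_mmap coef_sum big1 // => j _.
  by rewrite coef0M coef_deriv coef_coord Phi1 coef0 mul0rn mulr0.
apply: (mulfI (char0 2)); rewrite mulr0.
have := congr1 (fun p : {poly K} => p`_2) H; rewrite coef0 coef_sum => {}H.
rewrite -[RHS]H mulr_sumr; apply: eq_bigr => i _.
rewrite coefM !big_ord_recl big_ord0 /= /bump /=.
rewrite !coef_deriv !coef_coord Phi1 coef0 d1 mulr1n mulr0 mul0r !add0r !addr0.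
by rewrite mulrC -mulrA -meval_curve0 mxE mulr_natr.
Qed.

End CurveTangent.

(** * Polynomials with prescribed roots and multiplicities *)

Lemma deriv_prod (R : comNzRingType) (l : nat) (f : nat -> {poly R}) :
  (\prod_(i < l) f i)^`() =
  \sum_(i < l) (f i)^`() * \prod_(j < l | (j : nat) != i) f j.
Proof.
elim: l => [|l IH]; first by rewrite !big_ord0 derivC.
rewrite !big_ord_recr /= derivM IH mulr_suml; congr (_ + _).
  apply: eq_bigr => i _; rewrite -mulrA; congr (_ * _).
  rewrite [RHS]big_mkcond big_ord_recr /= -big_mkcond /=.
  by rewrite gtn_eqF.
rewrite mulrC; congr (_ * _).
rewrite [RHS]big_mkcond big_ord_recr /= eqxx mulr1.
by apply: eq_bigr => i _; rewrite ltn_eqF.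
Qed.

Lemma exists_gt1 (I : finType) (P : pred I) (m : I -> nat) :
  (\sum_(i | P i) 1 < \sum_(i | P i) m i)%N -> exists2 i, P i & (1 < m i)%N.
Proof.
move=> lt_sum; apply: contrapT => H; move: lt_sum; rewrite ltnNge => /negP; apply.
apply: leq_sum => i Pi; rewrite leqNgt; apply/negP => mi.
by apply: H; exists i.
Qed.

Section RootProducts.
Variable K : fieldType.
Implicit Types (l : nat) (s : nat -> K) (m : nat -> nat).

(** Roots and multiplicities are sequences indexed by nat, so that changing the
    number l of roots needs no casts. *)
Definition rprod l s m : {poly K} := \prod_(a < l) ('X - (s a)%:P) ^+ m a.
Definition radical l s : {poly K} := \prod_(a < l) ('X - (s a)%:P).
Definition cofactor_at l s (a : nat) : {poly K} :=
  \prod_(b < l | (b : nat) != a) ('X - (s b)%:P).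
(** The greatest common divisor of rprod l s m and its derivative, when the
    roots are distinct and the multiplicities positive. *)
Definition rgcd l s m : {poly K} := rprod l s (fun a => (m a).-1).
(** The numerator of the logarithmic derivative of rprod l s m. *)
Definition logder l s m : {poly K} :=
  \sum_(a < l) (m a)%:R *: cofactor_at l s a.

Lemma rprod_monic l s m : rprod l s m \is monic.
Proof. by apply: monic_prod => a _; apply: monic_exp; exact: monicXsubC. Qed.

Lemma rgcd_monic l s m : rgcd l s m \is monic.
Proof. exact: rprod_monic. Qed.

Lemma size_rprod l s m : size (rprod l s m) = (\sum_(a < l) m a).+1.
Proof.
rewrite /rprod; elim: l => [|l IH]; first by rewrite !big_ord0 size_poly1.
rewrite !big_ord_recr /= size_Mmonic ?monic_exp ?monicXsubC //; last first.
  by rewrite monic_neq0 // rprod_monic.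
by rewrite IH size_exp_XsubC addnS addSn.
Qed.

Lemma radical_monic l s : radical l s \is monic.
Proof. by apply: monic_prod => a _; exact: monicXsubC. Qed.

Lemma size_radical l s : size (radical l s) = l.+1.
Proof. by rewrite size_prod_XsubC /index_enum -enumT size_enum_ord. Qed.

Lemma radicalE l s (a : 'I_l) :
  radical l s = ('X - (s a)%:P) * cofactor_at l s a.
Proof.
by rewrite /radical (bigD1 a).
Qed.

Lemma cofactor_monic l s a : cofactor_at l s a \is monic.
Proof. by apply: monic_prod => b _; exact: monicXsubC. Qed.

Lemma size_cofactor l s (a : 'I_l) : size (cofactor_at l s a) = l.
Proof.
have := size_radical l s; rewrite (radicalE s a) mulrC size_Mmonic ?monicXsubC //.
  by rewrite size_XsubC addn2 => -[].
by rewrite monic_neq0 // cofactor_monic.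
Qed.

Lemma size_logder l s m : (size (logder l s m) <= l)%N.
Proof.
apply: (leq_trans (size_sum _ _ _)); apply/bigmax_leqP => a _.
by rewrite (leq_trans (size_scale_leq _ _)) // size_cofactor.
Qed.

Section Positive.
Variables (l : nat) (s : nat -> K) (m : nat -> nat).
Hypothesis m_gt0 : forall a, (a < l)%N -> (0 < m a)%N.

Lemma rprod_rgcd : rprod l s m = rgcd l s m * radical l s.
Proof.
rewrite /rprod /rgcd /radical -big_split; apply: eq_bigr => a _ /=.
by rewrite -exprSr prednK ?m_gt0.
Qed.

Lemma rgcd_cofactor (a : 'I_l) :
  ('X - (s a)%:P) ^+ (m a).-1 *
    \prod_(b < l | (b : nat) != a) ('X - (s b)%:P) ^+ m b =
  rgcd l s m * cofactor_at l s a.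
Proof.
rewrite /rgcd /rprod /cofactor_at [in RHS](bigD1 a) //= -mulrA; congr (_ * _).
rewrite [X in _ = X * _](eq_bigl (fun b : 'I_l => (b : nat) != a)); last first.
  by move=> b; rewrite -val_eqE.
rewrite -big_split; apply: eq_bigr => b _ /=.
by rewrite -exprSr prednK ?m_gt0.
Qed.

Lemma deriv_rprod : (rprod l s m)^`() = rgcd l s m * logder l s m.
Proof.
rewrite /rprod (deriv_prod _ (fun a => ('X - (s a)%:P) ^+ m a)) mulr_sumr.
apply: eq_bigr => a _; rewrite deriv_exp derivXsubC mul1r -scalerAr.
by rewrite scaler_nat mulrnAl rgcd_cofactor.
Qed.

End Positive.

Section Distinct.
Variables (l : nat) (s : nat -> K) (m : nat -> nat).
Hypothesis s_inj : injective (fun a : 'I_l => s a).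

Lemma horner_cofactor (a b : 'I_l) : a != b -> (cofactor_at l s a).[s b] = 0.
Proof.
move=> ab; rewrite /cofactor_at horner_prod (bigD1 b) 1?eq_sym //=.
by rewrite hornerXsubC subrr mul0r.
Qed.

Lemma horner_cofactor_neq0 (a : 'I_l) : (cofactor_at l s a).[s a] != 0.
Proof.
rewrite /cofactor_at horner_prod; apply/prodf_neq0 => b ba.
rewrite hornerXsubC subr_eq0; apply: contra ba => /eqP/(@s_inj a b) ab.
by rewrite ab.
Qed.

Lemma horner_logder (a : 'I_l) :
  (logder l s m).[s a] = (m a)%:R * (cofactor_at l s a).[s a].
Proof.
rewrite horner_sum (bigD1 a) //= hornerZ big1 ?addr0 // => b ba.
by rewrite hornerZ horner_cofactor // mulr0.
Qed.

Lemma uniq_roots_of : uniq [seq s a | a : 'I_l <- enum 'I_l].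
Proof. by rewrite map_inj_uniq ?enum_uniq. Qed.

(** Lagrange interpolation is unique. *)
Lemma eq_poly_distinct (p q : {poly K}) : (size p <= l)%N -> (size q <= l)%N ->
  (forall a : 'I_l, p.[s a] = q.[s a]) -> p = q.
Proof.
move=> sp sq pq; apply/eqP; rewrite -subr_eq0; apply/eqP.
apply: (@roots_geq_poly_eq0 _ _ [seq s a | a : 'I_l <- enum 'I_l]).
- by apply/allP => _ /mapP[a _ ->]; rewrite rootE !hornerE pq subrr.
- exact: uniq_roots_of.
- rewrite size_map size_enum_ord (leq_trans (size_polyD _ _)) //.
  by rewrite size_polyN geq_max sp.
Qed.

End Distinct.

Lemma root_rprod l s m z : root (rprod l s m) z -> exists a : 'I_l, z = s a.
Proof.
rewrite /root horner_prod prodf_seq_eq0 => /hasP[a _ /=].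
by rewrite horner_exp hornerXsubC expf_eq0 subr_eq0 => /andP[_ /eqP->]; exists a.
Qed.

Lemma rprod_root l s m (a : 'I_l) : (0 < m a)%N -> root (rprod l s m) (s a).
Proof.
move=> ma; rewrite /root horner_prod (bigD1 a) //= horner_exp hornerXsubC subrr.
by rewrite expr0n (gtn_eqF ma) mul0r.
Qed.

(** One copy of a repeated root is listed separately, as a new root. *)
Lemma rprod_split l s m : (forall a, (a < l)%N -> (0 < m a)%N) ->
  (l < \sum_(a < l) m a)%N -> exists s' m',
  (forall a, (a < l.+1)%N -> (0 < m' a)%N) /\
  rprod l s m = rprod l.+1 s' m'.
Proof.
move=> m0 lt_l.
have [|a _ ma] := @exists_gt1 'I_l predT (fun a => m a).
  by rewrite sum1_card card_ord.
exists (fun b => if b == l then s a else s b).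
exists (fun b => if b == l then 1%N else if b == a then (m a).-1 else m b).
split=> [b|].
  rewrite ltnS leq_eqVlt; case: eqP => //= _ bl; case: eqP => [_|_].
    by rewrite -subn1 subn_gt0.
  exact: m0.
rewrite /rprod big_ord_recr /= eqxx expr1 (bigD1 a) //= [in RHS](bigD1 a) //=.
rewrite eqxx !(ltn_eqF (ltn_ord a)) mulrAC -exprSr prednK; last exact: m0.
congr (_ * _); apply: eq_bigr => b ba.
by rewrite (ltn_eqF (ltn_ord b)) -[(b : nat) == a]/(b == a) (negbTE ba).
Qed.

(** A polynomial with few roots is a degenerate member of the family of
    polynomials with k roots, as long as its degree allows k roots. *)
Lemma rprod_splits l k s m : (forall a, (a < l)%N -> (0 < m a)%N) ->
  (l <= k <= \sum_(a < l) m a)%N -> exists s' m',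
  (forall a, (a < k)%N -> (0 < m' a)%N) /\ rprod l s m = rprod k s' m'.
Proof.
move=> m0 /andP[lk kn]; elim: k lk kn => [|k IH] lk kn.
  by move: lk; rewrite leqn0 => /eqP l0; exists s, m; rewrite l0 in m0 *.
move: lk; rewrite leq_eqVlt => /orP[/eqP<-|lk]; first by exists s, m.
have [s1 [m1 [m10 E1]]] := IH lk (ltnW kn).
have [|s' [m' [m'0 E']]] := @rprod_split k s1 m1 m10.
  by have := size_rprod l s m; rewrite E1 size_rprod => -[->].
by exists s', m'; rewrite E1.
Qed.

End RootProducts.

Lemma exists_rprod (K : closedFieldType) (p : {poly K}) : p \is monic ->
  exists l (s : nat -> K) m, [/\ injective (fun a : 'I_l => s a),
    forall a, (a < l)%N -> (0 < m a)%N & p = rprod l s m].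
Proof.
move=> pm; have [r] := closed_field_poly_normal p.
rewrite (monicP pm) scale1r => ->.
exists (size (undup r)), (nth 0 (undup r)).
exists (fun a => count_mem (nth 0 (undup r) a) r); split.
- move=> a b /eqP; rewrite nth_uniq ?undup_uniq // => /eqP; exact: val_inj.
- by move=> a la; rewrite -has_count has_pred1 -mem_undup mem_nth.
- rewrite -prodr_undup_exp_count (big_nth 0) big_mkord.
  by apply: eq_bigr.
Qed.

(** * A matrix of Sylvester type cutting out Z_k *)

Section Sylvester.
Variables (n k : nat).

(** The matrix, acting on rows, of (A, B) |-> A F + B F' for deg A < k and
    deg B <= k; when F has degree n the values have degree less than n + k. *)
Definition syl (A : comNzRingType) (F : {poly A}) : 'M[A]_(k + k.+1, n + k) :=
  col_mx (\matrix_(i < k, j < n + k) ('X^i * F)`_j)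
         (\matrix_(i < k.+1, j < n + k) ('X^i * F^`())`_j).

Lemma map_syl (A B : comNzRingType) (f : {rmorphism A -> B}) (F : {poly A}) :
  map_mx f (syl F) = syl (map_poly f F).
Proof.
rewrite /syl map_col_mx; congr col_mx; apply/matrixP => i j; rewrite !mxE.
  by rewrite -coef_map rmorphM /= map_polyXn.
by rewrite -coef_map rmorphM /= map_polyXn deriv_map.
Qed.

Lemma sylD (A : comNzRingType) (F G : {poly A}) : syl (F + G) = syl F + syl G.
Proof.
rewrite /syl add_col_mx; congr col_mx; apply/matrixP => i j; rewrite !mxE.
  by rewrite mulrDr coefD.
by rewrite derivD mulrDr coefD.
Qed.

Lemma sylZ (A : comNzRingType) c (F : {poly A}) : syl (c *: F) = c *: syl F.
Proof.
rewrite /syl scale_col_mx; congr col_mx; apply/matrixP => i j; rewrite !mxE.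
  by rewrite -scalerAr coefZ.
by rewrite derivZ -scalerAr coefZ.
Qed.

Lemma mul_syl (A : comNzRingType) (F : {poly A}) (a : 'rV_k) (b : 'rV_k.+1) :
  row_mx a b *m syl F = poly_rV (rVpoly a * F + rVpoly b * F^`()).
Proof.
rewrite mul_row_col; apply/rowP => j; rewrite !mxE coefD !rVpolyE !mulr_suml.
rewrite !coef_sum; congr (_ + _); apply: eq_bigr => i _; rewrite mxE.
  by rewrite -scalerAl coefZ.
by rewrite -scalerAl coefZ.
Qed.

End Sylvester.

Section SylvesterRank.
Variables (K : closedFieldType) (n : nat).
Hypothesis char0 : forall j : nat, j.+1%:R != 0 :> K.

Lemma size_syzygy k (a b F : {poly K}) :
  (size a <= k)%N -> (size b <= k.+1)%N -> (size F <= n.+1)%N ->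
  (size (a * F + b * F^`())%R <= n + k)%N.
Proof.
move=> sa sb sF; rewrite (leq_trans (size_polyD _ _)) // geq_max.
have sF' : (size F^`() <= n)%N.
  have [->|F0] := eqVneq F 0; first by rewrite deriv0 size_poly0.
  by rewrite -ltnS (leq_trans (lt_size_deriv F0)).
apply/andP; split; apply: (leq_trans (size_polyMleq _ _)).
  by have := leq_add sa sF; rewrite addnS [(k + n)%N]addnC; case: (_ + _)%N.
by have := leq_add sb sF'; rewrite addSn [(k + n)%N]addnC; case: (_ + _)%N.
Qed.

Lemma syl_eq0 k (F : {poly K}) (a : 'rV_k) (b : 'rV_k.+1) : size F = n.+1 ->
  row_mx a b *m syl n k F = 0 -> rVpoly a * F + rVpoly b * F^`() = 0.
Proof.
move=> sF; rewrite mul_syl => /(congr1 rVpoly); rewrite linear0 poly_rV_K //.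
by apply: size_syzygy; rewrite ?size_poly ?sF.
Qed.

Section DistinctRoots.
Variables (l : nat) (s : nat -> K) (m : nat -> nat).
Hypothesis s_inj : injective (fun a : 'I_l => s a).
Hypothesis m_gt0 : forall a, (a < l)%N -> (0 < m a)%N.
Let F := rprod l s m.

Lemma horner_logder_neq0 (a : 'I_l) : (logder l s m).[s a] != 0.
Proof.
rewrite horner_logder // mulf_neq0 ?horner_cofactor_neq0 //.
by rewrite -(prednK (m_gt0 (ltn_ord a))) char0.
Qed.

Lemma rgcd_neq0 : rgcd l s m != 0.
Proof. by rewrite monic_neq0 // rprod_monic. Qed.

Lemma syzygy_vanish (a b : {poly K}) : a * F + b * F^`() = 0 ->
  a * radical l s + b * logder l s m = 0.
Proof.
rewrite /F deriv_rprod // rprod_rgcd // mulrCA [b * _]mulrCA -mulrDr => /eqP.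
by rewrite mulf_eq0 (negbTE rgcd_neq0) => /eqP.
Qed.

Lemma horner_radical (i : 'I_l) : (radical l s).[s i] = 0.
Proof. by rewrite (radicalE s i) hornerM hornerXsubC subrr mul0r. Qed.

(** After division by the common factor, A P + B L = 0, and L is nonzero at the
    roots. *)
Lemma syzygy_root (a b : {poly K}) (i : 'I_l) : a * F + b * F^`() = 0 ->
  b.[s i] = 0.
Proof.
move=> /syzygy_vanish/(congr1 (horner^~ (s i))).
rewrite /= hornerD !hornerM horner_radical mulr0 add0r horner0 => /eqP.
by rewrite mulf_eq0 (negbTE (horner_logder_neq0 i)) orbF => /eqP.
Qed.

(** The syzygy (-F' / gcd(F, F')) F + (F / gcd(F, F')) F' = 0. *)
Definition syzygy_row k : 'rV[K]_(k + k.+1) :=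
  row_mx (poly_rV (- logder l s m)) (poly_rV (radical l s)).

Lemma mul_syzygy_rowE k (G : {poly K}) : (l <= k)%N ->
  syzygy_row k *m syl n k G =
  poly_rV (- logder l s m * G + radical l s * G^`()).
Proof.
move=> lk; rewrite mul_syl !poly_rV_K ?size_polyN ?size_radical //.
exact: leq_trans (size_logder _ _ _) lk.
Qed.

Lemma mul_syzygy_row k : (l <= k)%N -> syzygy_row k *m syl n k F = 0.
Proof.
move=> lk; rewrite mul_syzygy_rowE // /F deriv_rprod // rprod_rgcd // mulNr.
by rewrite mulrCA [radical l s * _]mulrCA [logder _ _ _ * _]mulrC addNr linear0.
Qed.

(** If k < l a syzygy (A, B) has deg B < l, so that B, which vanishes at the l
    roots, is zero; if l <= k the row syzygy_row fits in the matrix. *)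
Lemma syl_row_freeP k : size F = n.+1 ->
  row_free (syl n k F) <-> (k < l)%N.
Proof.
move=> sF; split; last first.
  move=> kl; apply: inj_row_free => v.
  rewrite -[v]hsubmxK => /(syl_eq0 sF) E.
  have b0 : rVpoly (rsubmx v) = 0.
    apply: (eq_poly_distinct s_inj); rewrite ?size_poly0 //.
      by rewrite (leq_trans (size_poly _ _)).
    by move=> i; rewrite horner0 (syzygy_root _ E).
  have /eqP : rVpoly (lsubmx v) * F = 0 by rewrite -E b0 mul0r addr0.
  rewrite mulf_eq0 -[F == 0]size_poly_eq0 sF orbF => /eqP a0.
  by rewrite -[lsubmx v]rVpolyK -[rsubmx v]rVpolyK a0 b0 !linear0 row_mx0.
move=> /row_free_inj inj; rewrite ltnNge; apply/negP => lk.
have v0 : syzygy_row k = 0 by apply: inj; rewrite mul0mx mul_syzygy_row.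
have /(congr1 (rVpoly \o rsubmx)) := v0; rewrite /= row_mxKr linear0 linear0.
rewrite poly_rV_K ?size_radical // => /eqP.
by rewrite -size_poly_eq0 size_radical.
Qed.

End DistinctRoots.

Lemma in_Z_roots (L : seq K) k (g : 'rV[K]_n) :
  (forall z, root (monic_poly_of (g 0)) z -> z \in L) -> (size L <= k)%N ->
  Z K n k g.
Proof.
move=> rL Lk t ut /allP rt; apply: leq_trans Lk.
by apply: uniq_leq_size => // z /rt; exact: rL.
Qed.

Lemma in_Z l s m k (g : 'rV[K]_n) : monic_poly_of (g 0) = rprod l s m ->
  (l <= k)%N -> Z K n k g.
Proof.
move=> E lk; apply: (@in_Z_roots [seq s a | a : 'I_l <- enum 'I_l]) => [z|].
  by rewrite E => /root_rprod[a ->]; apply/mapP; exists a; rewrite ?mem_enum.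
by rewrite size_map size_enum_ord.
Qed.

Lemma Z_distinct l (s : nat -> K) m k (g : 'rV[K]_n) :
  injective (fun a : 'I_l => s a) -> (forall a, (a < l)%N -> (0 < m a)%N) ->
  monic_poly_of (g 0) = rprod l s m -> Z K n k g <-> (l <= k)%N.
Proof.
move=> si m0 E; split=> [H|]; last exact: in_Z E.
rewrite -[leqLHS](size_enum_ord l) -(size_map (fun a : 'I_l => s a)).
apply: H; first exact: uniq_roots_of.
apply/allP => _ /mapP[a _ ->]; rewrite E; apply: rprod_root; exact: m0.
Qed.

Lemma exists_rprod_point (g : 'rV[K]_n) : exists l (s : nat -> K) m,
  [/\ injective (fun a : 'I_l => s a), forall a, (a < l)%N -> (0 < m a)%N,
    (\sum_(a < l) m a = n)%N & monic_poly_of (g 0) = rprod l s m].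
Proof.
have [l [s [m [si m0 E]]]] := exists_rprod (monic_poly_of_monic g).
exists l, s, m; split=> //.
by have := size_monic_poly_of (g 0); rewrite E size_rprod => -[].
Qed.

Lemma Z_syl k (g : 'rV[K]_n) :
  Z K n k g <-> ~ row_free (syl n k (monic_poly_of (g 0))).
Proof.
have [l [s [m [si m0 _ E]]]] := exists_rprod_point g.
rewrite (Z_distinct _ si m0 E) E syl_row_freeP // -?E ?size_monic_poly_of //.
by rewrite leqNgt; split=> /negP.
Qed.

Definition generic_syl k := syl n k (generic_poly K n).

Lemma map_generic_poly (A : comNzRingType)
    (f : {rmorphism {mpoly K[n]} -> A}) :
  map_poly f (generic_poly K n) = monic_poly_of (fun i => f 'X_i).
Proof.
rewrite /generic_poly /monic_poly_of rmorphD /= map_polyXn; congr (_ + _).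
rewrite rmorph_sum; apply: eq_bigr => i _.
by rewrite /= map_polyZ map_polyXn.
Qed.

Lemma meval_generic_syl k (g : 'rV[K]_n) :
  map_mx (meval (g 0)) (generic_syl k) = syl n k (monic_poly_of (g 0)).
Proof.
rewrite map_syl map_generic_poly; congr syl.
rewrite /monic_poly_of; congr (_ + _); apply: eq_bigr => i _.
by congr (_ *: _); exact: mevalXU.
Qed.

(** A matrix has a right inverse if and only if its product with some matrix C
    is invertible, so the determinants of these products for all C serve as
    equations in place of the maximal minors. *)
Lemma Z_algebraic k : algebraic (Z K n k).
Proof.
exists [set f | exists C : 'M[K]_(n + k, k + k.+1),
  f = \det (generic_syl k *m map_mx (@mpolyC n K) C)].
have detE (g : 'rV[K]_n) C : (\det (generic_syl k *m map_mx (@mpolyC n K) C)).@[g 0] =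
    \det (syl n k (monic_poly_of (g 0)) *m C).
  rewrite -[LHS]/(meval (g 0) _) -det_map_mx map_mxM /=.
  rewrite meval_generic_syl.
  rewrite -map_mx_comp map_mx_id // => c; exact: mevalC.
apply/seteqP; split=> g.
  move=> /Z_syl nfree f [C ->]; rewrite detE; apply/eqP.
  apply: contrapT => /negP; rewrite -unitfE -unitmxE => U; apply: nfree.
  apply/row_freeP; exists (C *m invmx (syl n k (monic_poly_of (g 0)) *m C)).
  by rewrite mulmxA mulmxV.
move=> H; apply/Z_syl => /row_freeP[C CE].
have := H _ (ex_intro _ C erefl); rewrite detE CE det1 => /eqP.
by rewrite oner_eq0.
Qed.

End SylvesterRank.

(** * Tangent spaces of determinantal loci *)

(** The first row of the perturbed matrix is divisible by the parameter; once
    this factor is taken out, the parameter can be set to 0. *)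
Lemma det_first_order (K : fieldType) r (M N : 'M[K]_(1 + r)) :
  M = block_mx 0 0 0 1%:M ->
  (\det (map_mx polyC M + 'X *: map_mx polyC N))`_1 = N 0 0.
Proof.
move=> ->; rewrite -[in LHS](submxK N) map_block_mx !map_mx0 map_mx1.
set a := ulsubmx N; set b := ursubmx N; set c := dlsubmx N; set d := drsubmx N.
rewrite map_block_mx scale_block_mx add_block_mx !add0r.
set T := block_mx _ _ _ _.
pose T' := block_mx (map_mx polyC a) (map_mx polyC b)
   ('X *: map_mx polyC c) (1%:M + 'X *: map_mx polyC d).
have -> : T = block_mx 'X%:M 0 0 1%:M *m T'.
  by rewrite mulmx_block !mul_scalar_mx !mul0mx !addr0 !add0r !scale1r.
rewrite det_mulmx det_ublock det_scalar1 det1 mulr1 coefXM /=.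
rewrite -horner_coef0 -horner_evalE -det_map_mx.
have -> : map_mx (horner_eval 0) T' = block_mx a b 0 1%:M.
  rewrite map_block_mx; congr block_mx; apply/matrixP => i j;
    rewrite !mxE /horner_eval ?hornerC //.
    by rewrite hornerM hornerX mul0r.
  by rewrite hornerD hornerM hornerX mul0r addr0 hornerMn hornerC.
rewrite det_ublock det1 mulr1 det_mx11 !mxE.
by congr (N _ _); exact: val_inj.
Qed.

Section Determinantal.
Variables (K : closedFieldType) (n : nat).

Definition affine_line (g v : 'rV[K]_n) (i : 'I_n) : {poly K} :=
  (g 0 i)%:P + v 0 i *: 'X.

Lemma coef1_mmap_affine_line g v (f : {mpoly K[n]}) :
  (mmap polyC (affine_line g v) f)`_1 = \sum_(i < n) f^`M(i).@[g 0] * v 0 i.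
Proof.
rewrite -[LHS]mulr1n -coef_deriv deriv_mmap coef_sum; apply: eq_bigr => i _.
rewrite coef0M -horner_coef0 horner_mmap; congr (_ * _).
  apply: meval_eq => j; rewrite /affine_line hornerD hornerC hornerZ hornerX mulr0.
  by rewrite addr0.
by rewrite /affine_line derivD derivC derivZ derivX add0r alg_polyC coefC.
Qed.

(** If the rank cannot exceed rank M0 on W, a tangent vector moves the left
    kernel of M0 into its row space: for w in the left kernel and u in the right
    kernel of M0, w N u is the first-order term of a determinant of size
    1 + rank M0, of the form \det (R M C) with constant R and C. *)
Lemma tangent_determinantal (W : set 'rV[K]_n) (g v : 'rV[K]_n) a b
    (M : 'M[{mpoly K[n]}]_(a, b)) (M0 N : 'M[K]_(a, b)) :
  (forall h, W h ->
    (\rank (map_mx (meval (h 0%R)) M) <= \rank M0)%N) ->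
  map_mx (mmap polyC (affine_line g v)) M =
    map_mx polyC M0 + 'X *: map_mx polyC N ->
  tangent_space W g v ->
  forall w : 'rV_a, w *m M0 = 0 -> (w *m N <= M0)%MS.
Proof.
move=> rkW ME Tv w w0; rewrite submxE; apply/eqP/rowP => j; rewrite [RHS]mxE.
pose u := cokermx M0 *m delta_mx j (0 : 'I_1).
have u0 : M0 *m u = 0 by rewrite /u mulmxA mulmx_coker mul0mx.
have [R' R'E] := row_fullP (col_base_full M0).
have [C' C'E] := row_freeP (row_base_free M0).
(* The outer factors are chosen so that R M0 C = block_mx 0 0 0 1. *)
pose R : 'M_(1 + \rank M0, a) := col_mx w R'.
pose C : 'M_(b, 1 + \rank M0) := row_mx u C'.
pose f := \det (map_mx (@mpolyC n K) R *m M *m map_mx (@mpolyC n K) C).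
have If : vanishing_ideal W f.
  move=> h Wh; rewrite /f -[LHS]/(meval (h 0) _) -det_map_mx !map_mxM /=.
  rewrite -!map_mx_comp !map_mx_id; try by move=> c; exact: mevalC.
  apply/eqP; apply: contrapT => /negP; rewrite -unitfE -unitmxE => U.
  have := mxrank_unit U; apply/eqP; rewrite ltn_eqF // ltnS.
  apply: leq_trans (rkW h Wh); apply: (leq_trans (mxrankM_maxl _ _)).
  exact: mxrankM_maxr.
have mC p q (B : 'M[K]_(p, q)) :
    map_mx (mmap polyC (affine_line g v)) (map_mx (@mpolyC n K) B) = map_mx polyC B.
  by rewrite -map_mx_comp; apply/matrixP => i k; rewrite !mxE /= mmapC.
have fE : mmap polyC (affine_line g v) f =
    \det (map_mx polyC (R *m M0 *m C) + 'X *: map_mx polyC (R *m N *m C)).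
  rewrite /f -det_map_mx !map_mxM /= ME !mC.
  by rewrite mulmxDr mulmxDl -scalemxAr -scalemxAl.
have := Tv f If; rewrite -coef1_mmap_affine_line fE.
rewrite det_first_order.
  move=> H; rewrite -[LHS](_ : (w *m N *m u) 0 0 = _); last first.
    by rewrite /u mulmxA -colE [LHS]mxE.
  move: H; rewrite mul_col_mx mul_col_row.
  by rewrite -[0 in X in X -> _](lshift0 _ 0) block_mxEul.
rewrite mul_col_mx w0 mul_col_row !mul0mx -mulmxA u0 mulmx0.
congr block_mx; transitivity (R' *m (col_base M0 *m row_base M0) *m C').
  by rewrite mulmx_base.
by rewrite mulmxA R'E mul1mx C'E.
Qed.

End Determinantal.

(** * The tangent space at a polynomial with exactly k roots *)

Section MovingRoots.
Variables (K : fieldType) (l : nat) (s d : nat -> K) (m : nat -> nat).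

Definition moving_roots : {poly {poly K}} :=
  \prod_(a < l) (('X - (s a)%:P)%:P - (d a)%:P *: 'X) ^+ m a.

Lemma horner_moving_roots t :
  moving_roots.[t%:P] = rprod l (fun a => s a + t * d a) m.
Proof.
rewrite horner_prod; apply: eq_bigr => a _; rewrite horner_exp; congr (_ ^+ _).
by rewrite hornerD hornerN hornerZ hornerX hornerC -polyCM polyCD opprD addrA mulrC.
Qed.

Lemma coef0_moving_roots : moving_roots`_0 = rprod l s m.
Proof.
rewrite -horner_coef0 -polyC0 horner_moving_roots.
by apply: eq_bigr => a _; rewrite mul0r addr0.
Qed.

Hypothesis m_gt0 : forall a, (a < l)%N -> (0 < m a)%N.

Lemma coef1_moving_roots : moving_roots`_1 =
  - \sum_(a < l) ((m a)%:R * d a) *: (rgcd l s m * cofactor_at l s a).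
Proof.
rewrite -[LHS]mulr1n -coef_deriv -horner_coef0 /moving_roots.
rewrite (deriv_prod _
  (fun a => (('X - (s a)%:P)%:P - (d a)%:P *: 'X) ^+ m a)).
rewrite horner_sum -sumrN; apply: eq_bigr => a _; rewrite hornerM horner_prod.
rewrite deriv_exp derivB derivC derivZ derivX sub0r.
have E b : (('X - (s b)%:P)%:P - (d b)%:P *: 'X).[0] = 'X - (s b)%:P.
  by rewrite hornerD hornerN hornerZ hornerX hornerC mulr0 subr0.
rewrite hornerMn hornerM horner_exp E hornerN alg_polyC hornerC mulNr.
rewrite mulNrn mulNr; congr (- _); rewrite -(rgcd_cofactor s m_gt0 a).
rewrite mul_polyC [in LHS]mulrnAl -scalerAl -scaler_nat scalerA; congr (_ *: (_ * _)).
by apply: eq_bigr => b _; rewrite horner_exp E.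
Qed.

End MovingRoots.

Section TangentLinear.
Variables (K : closedFieldType) (n : nat) (W : set 'rV[K]_n) (g : 'rV[K]_n).

Lemma tangentZ c v : tangent_space W g v -> tangent_space W g (c *: v).
Proof.
move=> Tv f If; transitivity (c * \sum_(i < n) f^`M(i).@[g 0] * v 0 i).
  by rewrite mulr_sumr; apply: eq_bigr => i _; rewrite mxE mulrCA.
by rewrite (Tv f If) mulr0.
Qed.

Lemma tangentD u v : tangent_space W g u -> tangent_space W g v ->
  tangent_space W g (u + v).
Proof.
move=> Tu Tv f If; transitivity (\sum_(i < n)
    (f^`M(i).@[g 0] * u 0 i + f^`M(i).@[g 0] * v 0 i)).
  by apply: eq_bigr => i _; rewrite mxE mulrDr.
by rewrite big_split /= (Tu f If) (Tv f If) addr0.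
Qed.

Lemma tangent0 : tangent_space W g 0.
Proof. by move=> f If; rewrite big1 // => i _; rewrite mxE mulr0. Qed.

Lemma tangent_mulmx d (B : 'M_(d, n)) (c : 'rV_d) :
  (forall i, tangent_space W g (row i B)) -> tangent_space W g (c *m B).
Proof.
move=> TB; rewrite mulmx_sum_row; apply: big_ind => [|u v|i _].
- exact: tangent0.
- exact: tangentD.
- exact/tangentZ.
Qed.

End TangentLinear.

Section Wronskian.
Variables (K : fieldType) (l : nat) (s : nat -> K) (m : nat -> nat).
Hypothesis char0 : forall j : nat, j.+1%:R != 0 :> K.
Hypothesis s_inj : injective (fun a : 'I_l => s a).

Lemma rprod_dvd (v : {poly K}) :
  (forall a : 'I_l, ('X - (s a)%:P) ^+ m a %| v) -> rprod l s m %| v.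
Proof.
move=> H; suff: forall i, (i <= l)%N -> rprod i s m %| v by apply.
elim=> [|i IH] il; first by rewrite /rprod big_ord0 dvd1p.
rewrite /rprod big_ord_recr /= Gauss_dvdp ?IH ?(ltnW il) //=.
  exact: (H (Ordinal il)).
apply: coprimep_expr; rewrite coprimep_XsubC; apply/negP => /root_rprod[a sa].
have la : (a < l)%N by rewrite (ltn_trans _ il).
have /(congr1 val) /= := @s_inj (Ordinal il) (Ordinal la) sa.
by move=> ia; move: (ltn_ord a); rewrite -ia ltnn.
Qed.

Lemma mulXsubC_deriv_exp (c : K) j :
  ('X - c%:P) * (('X - c%:P) ^+ j)^`() = j%:R *: ('X - c%:P) ^+ j.
Proof.
rewrite deriv_exp derivXsubC mul1r mulrnAr scaler_nat.
by case: j => [|j]; rewrite ?mulr0n //= exprS.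
Qed.

End Wronskian.

Section SmoothTangent.
Variables (K : closedFieldType) (n : nat).
Hypothesis char0 : forall j : nat, j.+1%:R != 0 :> K.

Lemma point_rprod l (s : nat -> K) (m : nat -> nat) : (\sum_(a < l) m a = n)%N ->
  monic_poly_of ((poly_rV (rprod l s m) : 'rV[K]_n) 0) = rprod l s m.
Proof.
by move=> sm; rewrite monic_poly_of_poly_rV ?rprod_monic // size_rprod sm.
Qed.

Lemma Z_moving l k (s d : nat -> K) (m : nat -> nat) :
  (\sum_(a < l) m a = n)%N -> (l <= k)%N -> forall t,
  Z K n k (poly_rV (moving_roots l s d m).[t%:P]).
Proof.
move=> sm lk t; rewrite horner_moving_roots.
exact: in_Z (point_rprod _ sm) lk.
Qed.

Section Point.
Variables (l : nat) (s : nat -> K) (m : nat -> nat).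
Hypothesis m_gt0 : forall a, (a < l)%N -> (0 < m a)%N.
Hypothesis sum_m : (\sum_(a < l) m a = n)%N.
Let F := rprod l s m.
Let g : 'rV[K]_n := poly_rV F.

(** The velocity when the single root s_a moves, up to the factor m_a. *)
Lemma tangent_cofactor k (a : 'I_l) : (l <= k)%N ->
  tangent_space (Z K n k) g (poly_rV (rgcd l s m * cofactor_at l s a)).
Proof.
move=> lk.
(* The speed of the root is chosen to cancel the coefficient - m_a. *)
pose d b : K := if b == a :> nat then - (m a)%:R^-1 else 0.
have := tangent_curve char0 (Z_moving (s := s) (d := d) sum_m lk).
rewrite coef0_moving_roots coef1_moving_roots // (bigD1 a) //= /d eqxx.
rewrite mulrN mulfV ?scaleN1r; last by rewrite -(prednK (m_gt0 (ltn_ord a))).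
rewrite big1 ?addr0 ?opprK // => b ba.
by rewrite -[(b : nat) == a]/(b == a) (negbTE ba) mulr0 scale0r.
Qed.

Definition cofactor_mx : 'M[K]_(l, n) :=
  \matrix_(a < l) poly_rV (rgcd l s m * cofactor_at l s a).

Lemma mul_cofactor_mx (c : 'rV_l) : c *m cofactor_mx =
  poly_rV (rgcd l s m * \sum_(a < l) c 0 a *: cofactor_at l s a).
Proof.
rewrite mulmx_sum_row mulr_sumr linear_sum; apply: eq_bigr => a _ /=.
by rewrite rowK -scalerAr linearZ.
Qed.

Lemma size_rgcd_add : (size (rgcd l s m) + l = n.+1)%N.
Proof.
have <- : size F = n.+1 by rewrite size_rprod sum_m.
rewrite /F rprod_rgcd // size_monicM ?rgcd_monic ?monic_neq0 ?radical_monic //.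
by rewrite size_radical addnS.
Qed.

Lemma size_rgcd_mul (h : {poly K}) :
  (size h <= l)%N -> (size (rgcd l s m * h)%R <= n)%N.
Proof.
move=> sh; have [->|h0] := eqVneq h 0; first by rewrite mulr0 size_poly0.
rewrite size_monicM ?rgcd_monic // -ltnS -size_rgcd_add.
apply: leq_trans (leq_add (leqnn _) sh).
by rewrite ltn_predL addn_gt0 orbC lt0n size_poly_eq0 h0.
Qed.

Hypothesis s_inj : injective (fun a : 'I_l => s a).

(** Lagrange interpolation. *)
Lemma cofactor_span (h : {poly K}) : (size h <= l)%N ->
  h = \sum_(a < l)
    (h.[s a] / (cofactor_at l s a).[s a]) *: cofactor_at l s a.
Proof.
move=> sh; apply: (eq_poly_distinct s_inj) => // [|b].
  apply: (leq_trans (size_sum _ _ _)); apply/bigmax_leqP => a _.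
  by rewrite (leq_trans (size_scale_leq _ _)) // size_cofactor.
rewrite horner_sum (bigD1 b) //= hornerZ big1 ?addr0 => [|a ab].
  by rewrite mulfVK ?horner_cofactor_neq0.
by rewrite hornerZ (horner_cofactor s ab) mulr0.
Qed.

Lemma cofactor_free (c : 'I_l -> K) :
  \sum_(a < l) c a *: cofactor_at l s a = 0 -> forall a, c a = 0.
Proof.
move=> /(congr1 (fun p => p.[s _])) H a; move: (H a) => {H}.
rewrite horner0 horner_sum (bigD1 a) //= hornerZ big1 ?addr0 => [/eqP|b ba].
  by rewrite mulf_eq0 (negbTE (horner_cofactor_neq0 s_inj a)) orbF => /eqP.
by rewrite hornerZ (horner_cofactor s ba) mulr0.
Qed.

Lemma monic_poly_of_rprod : monic_poly_of (g 0) = F.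
Proof. exact: point_rprod. Qed.

Lemma size_rprod_n : size F = n.+1.
Proof. by rewrite size_rprod sum_m. Qed.

(** In a syzygy (A, B) with deg B <= l the polynomial B vanishes at the l roots,
    hence is a multiple of the radical, and A is then determined: the left
    kernel is a line. *)
Lemma rank_syl : (l + l <= \rank (syl n l F))%N.
Proof.
have kerE : (kermx (syl n l F) <= syzygy_row l s m l)%MS.
  apply/row_subP => i; set w := row i _.
  have w0 : w *m syl n l F = 0 by apply/sub_kermxP; exact: row_sub.
  have := w0; rewrite -[w]hsubmxK => /(syl_eq0 size_rprod_n).
  set a := rVpoly _; set b := rVpoly _ => E.
  pose c := b`_l.
  have bE : b = c *: radical l s.
    apply/eqP; rewrite -subr_eq0; apply/eqP.
    apply: (eq_poly_distinct s_inj); rewrite ?size_poly0 //.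
      apply/leq_sizeP => j lj; rewrite coefB coefZ.
      have [->|jl] := eqVneq j l.
        have := radical_monic l s; rewrite monicE lead_coefE size_radical /=.
        by move=> /eqP->; rewrite mulr1 subrr.
      rewrite !nth_default ?mulr0 ?subr0 ?size_radical //.
        by rewrite ltn_neqAle eq_sym jl.
      by rewrite (leq_trans (size_poly _ _)) // ltn_neqAle eq_sym jl.
    move=> i0; rewrite horner0 !hornerE horner_radical mulr0 subr0.
    exact: (syzygy_root char0 s_inj m_gt0 i0 E).
  have aE : a = - c *: logder l s m.
    have := syzygy_vanish m_gt0 E; rewrite bE -scalerAl -mulrC.
    rewrite scalerAr -mulrDr => /eqP.
    rewrite mulf_eq0 -[radical l s == 0]size_poly_eq0 size_radical /= addr_eq0 => /eqP->.
    by rewrite scaleNr.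
  apply/sub_rVP; exists c; rewrite scale_row_mx -!linearZ /= -bE.
  by rewrite -scaleNr -aE !rVpolyK.
have := mxrankS kerE; rewrite mxrank_ker => H.
have := leq_trans H (rank_leq_row _).
by move: (\rank _) => r; rewrite leq_subLR addn1 addnS ltnS.
Qed.

(** If v vanishes to order j < m_a at s_a, then P v' - L v does so to order
    exactly j, because the leading coefficient is multiplied by
    (j - m_a) P'(s_a), which is nonzero in characteristic 0. As this order is at
    least m_a - 1, so is j. *)
Lemma rgcd_dvd_wronskian (v : {poly K}) :
  rgcd l s m %| - logder l s m * v + radical l s * v^`() -> rgcd l s m %| v.
Proof.
move=> dvdQ; apply: (rprod_dvd s_inj) => a.
suff: forall j, (j <= (m a).-1)%N -> ('X - (s a)%:P) ^+ j %| v by apply.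
elim=> [|j IH] ja; first by rewrite expr0 dvd1p.
have /dvdpP[w vE] := IH (ltnW ja).
set x := 'X - (s a)%:P in IH vE *.
have wE : - logder l s m * v + radical l s * v^`() = x ^+ j *
   (- logder l s m * w + radical l s * w^`() + j%:R *: (cofactor_at l s a * w)).
  rewrite vE derivM [radical l s * (_ + _)]mulrDr.
  rewrite [X in _ + (_ + X)](_ : _ = j%:R *: (cofactor_at l s a * w) * x ^+ j).
    by rewrite [in RHS]mulrC !mulrDl !mulrA addrA.
  rewrite (radicalE s a) -/x [x * _]mulrC mulrACA mulXsubC_deriv_exp.
  by rewrite -scalerAr -scalerAl.
have dvdx : x ^+ j.+1 %| - logder l s m * v + radical l s * v^`().
  apply: dvdp_trans dvdQ; rewrite /rgcd /rprod (bigD1 a) //=.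
  by apply: dvdp_mulr; exact: dvdp_exp2l.
move: dvdx; rewrite wE exprSr dvdp_mul2l ?expf_neq0 ?polyXsubC_eq0 //.
rewrite dvdp_XsubCl /root !hornerE horner_radical mul0r addr0.
rewrite horner_logder //= -mulNr -!mulrDl.
rewrite mulf_eq0 mulf_eq0 (negbTE (horner_cofactor_neq0 s_inj a)) orbF.
rewrite addrC subr_eq0.
rewrite (inj_eq (natr_inj0 char0)) ltn_eqF; last first.
  by rewrite (leq_trans ja) ?leq_pred.
rewrite /= => w0; rewrite vE [w * _]mulrC dvdp_mul2l ?expf_neq0 ?polyXsubC_eq0 //.
by rewrite dvdp_XsubCl.
Qed.

(** The tangent condition of the determinantal locus, applied to the syzygy
    (-L, P), says that P v' - L v is a combination of F and F'. *)
Lemma tangent_dvd (v : 'rV[K]_n) :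
  tangent_space (Z K n l) g v -> rgcd l s m %| rVpoly v.
Proof.
move=> Tv.
have rkZ h : Z K n l h ->
    (\rank (map_mx (meval (h 0%R)) (generic_syl K n l)) <= \rank (syl n l F))%N.
  rewrite meval_generic_syl => /(Z_syl char0) nf.
  apply: leq_trans rank_syl; rewrite -ltnS -addnS ltn_neqAle rank_leq_row andbT.
  exact/negP.
have lineE : map_mx (mmap polyC (affine_line g v)) (generic_syl K n l) =
    map_mx polyC (syl n l F) + 'X *: map_mx polyC (syl n l (rVpoly v)).
  rewrite /generic_syl !map_syl -sylZ -sylD -monic_poly_of_rprod; congr syl.
  rewrite map_generic_poly monic_poly_ofE rmorphD /= map_polyXn -addrA.
  rewrite /monic_poly_of; congr (_ + _).
  rewrite -!/(map_poly polyC _) !rVpolyE !rmorph_sum scaler_sumr -big_split.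
  apply: eq_bigr => i _; rewrite /= mmapXU /affine_line !map_polyZ /= !map_polyXn.
  rewrite scalerA -scalerDl; congr (_ *: _); congr (_ + _).
  by rewrite mulrC mul_polyC.
have := tangent_determinantal rkZ lineE Tv (mul_syzygy_row n s m_gt0 (leqnn l)).
rewrite mul_syzygy_rowE // => /submxP[c].
rewrite -[c]hsubmxK mul_syl => /(congr1 rVpoly).
rewrite !poly_rV_K ?size_syzygy ?size_poly ?size_rprod_n ?size_polyN ?size_logder //;
  try by rewrite ?size_radical // ltnW // ltnS size_poly.
move=> E; apply: rgcd_dvd_wronskian; rewrite E /F deriv_rprod // rprod_rgcd //.
by apply: dvdp_add; apply: dvdp_mull; apply: dvdp_mulr; exact: dvdpp.
Qed.

(** Tangent vectors are multiples of Q of degree less than n, and the quotient,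
    of degree less than l, is a combination of the cofactors P / ('X - s_a). *)
Theorem tangent_dim_distinct : tangent_dim (Z K n l) g l.
Proof.
exists cofactor_mx; split.
  apply: inj_row_free => c; rewrite mul_cofactor_mx => /(congr1 rVpoly).
  rewrite linear0 poly_rV_K; last first.
    apply: size_rgcd_mul; apply: (leq_trans (size_sum _ _ _)).
    apply/bigmax_leqP => a _.
    by rewrite (leq_trans (size_scale_leq _ _)) // size_cofactor.
  move=> /eqP; rewrite mulf_eq0 (negbTE (rgcd_neq0 l s m)) => /eqP.
  move=> /(@cofactor_free (fun a => c 0 a)) H.
  by apply/rowP => a; rewrite H mxE.
move=> v; split=> [Tv|/submxP[c ->]]; last first.
  apply: tangent_mulmx => a; rewrite rowK; exact: tangent_cofactor.
have /dvdpP[h] := tangent_dvd Tv; rewrite mulrC => vE.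
have sh : (size h <= l)%N.
  have [->|h0] := eqVneq h 0; first by rewrite size_poly0.
  have : (size (rVpoly v) <= n)%N by exact: size_poly.
  rewrite vE size_monicM ?rgcd_monic // => H.
  rewrite -(leq_add2l (size (rgcd l s m))) size_rgcd_add.
  by rewrite -ltnS in H; apply: leq_trans H; rewrite leqSpred.
apply/submxP; exists (\row_a (h.[s a] / (cofactor_at l s a).[s a])).
rewrite mul_cofactor_mx -[LHS]rVpolyK vE {1}(cofactor_span sh).
by congr poly_rV; congr (_ * _); apply: eq_bigr => a _; rewrite mxE.
Qed.

End Point.
End SmoothTangent.

(** * Zariski closures and irreducibility *)

Section Zariski.
Variables (K : closedFieldType) (n : nat).
Hypothesis char0 : forall j : nat, j.+1%:R != 0 :> K.
Implicit Types (W X Y A B : set 'rV[K]_n).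

Definition zariski_closure Y : set 'rV[K]_n :=
  zero_locus (vanishing_ideal Y).

Lemma closure_algebraic Y : algebraic (zariski_closure Y).
Proof. by exists (vanishing_ideal Y). Qed.

Lemma sub_closure Y : Y `<=` zariski_closure Y.
Proof. by move=> g Yg f; apply. Qed.

Lemma closure_sub Y A : algebraic A -> Y `<=` A -> zariski_closure Y `<=` A.
Proof.
by move=> [E ->] YA g Yg f Ef; apply: Yg => h /YA; apply.
Qed.

Lemma algebraic_sep A g : algebraic A -> ~ A g ->
  exists2 f, vanishing_ideal A f & f.@[g 0] != 0.
Proof.
move=> [E ->] nAg; apply: contrapT => H; apply: nAg => f Ef.
apply/eqP; apply: contrapT => /negP fg; apply: H; exists f => //.
by move=> h; apply.
Qed.

Lemma algebraicI1 A (f : {mpoly K[n]}) : algebraic A ->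
  algebraic (A `&` [set g | f.@[g 0] = 0]).
Proof.
move=> [E ->]; exists (E `|` [set f]); apply/seteqP; split=> g.
  by move=> [Eg fg] h [/Eg//|->].
by move=> H; split=> [h Eh|]; apply: H; [left|right].
Qed.

Lemma irreducible_prime X (f h : {mpoly K[n]}) : irreducible_closed X ->
  vanishing_ideal X (f * h) -> vanishing_ideal X f \/ vanishing_ideal X h.
Proof.
move=> [algX _ irr] Ifh.
have [||||] := irr (X `&` [set g | f.@[g 0] = 0])
  (X `&` [set g | h.@[g 0] = 0]).
- exact: algebraicI1.
- exact: algebraicI1.
- apply/seteqP; split=> g; last by move=> [[]|[]].
  move=> Xg; have /eqP := Ifh g Xg; rewrite mevalM mulf_eq0.
  by move=> /orP[] /eqP; [left|right].
- by move=> XE; left => g; rewrite XE => -[].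
- by move=> XE; right => g; rewrite XE => -[].
Qed.

Lemma irreducible_prime_prod X (I : finType) (f : I -> {mpoly K[n]}) :
  irreducible_closed X ->
  vanishing_ideal X (\prod_i f i) -> exists i, vanishing_ideal X (f i).
Proof.
move=> irrX; rewrite /index_enum; elim: (Finite.enum I) => [|i r IH].
  rewrite big_nil => I1; have [_ [g Xg] _] := irrX.
  by have /eqP := I1 g Xg; rewrite meval1 oner_eq0.
rewrite big_cons => /(irreducible_prime irrX)[]; first by exists i.
exact: IH.
Qed.

(** If the closure is a union of two proper closed sets A and B, take
    equations f of A and f' of B that are nonzero at points g and h of Y. On a
    polynomial curve in Y through g and h the product f f' vanishes although
    neither factor does, and polynomials in one variable form a domain. This
    avoids polynomial functions of several variables. *)
Lemma irreducible_closure_curves Y : Y !=set0 ->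
  (forall g h, Y g -> Y h -> exists (Phi : {poly {poly K}}) t u,
    [/\ forall r, Y (poly_rV Phi.[r%:P]), g = poly_rV Phi.[t%:P]
      & h = poly_rV Phi.[u%:P]]) ->
  irreducible_closed (zariski_closure Y).
Proof.
move=> [g0 Yg0] HY; split; first exact: closure_algebraic.
  by exists g0; exact: sub_closure.
move=> A B algA algB XE; apply: contrapT => /not_orP[nA nB].
have sub C : algebraic C -> C `<=` zariski_closure Y ->
    zariski_closure Y <> C -> exists2 g, Y g & ~ C g.
  move=> algC CX nC; apply: contrapT => H; apply: nC; apply/seteqP; split=> //.
  apply: closure_sub => // g Yg; apply: contrapT => nCg; apply: H.
  by exists g.
have [|g Yg /(algebraic_sep algA)[f fA fg]] := sub A algA _ nA.
  by rewrite XE => h; left.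
have [|h Yh /(algebraic_sep algB)[f' f'B f'h]] := sub B algB _ nB.
  by rewrite XE => k; right.
have [Phi [t [u [YPhi gE hE]]]] := HY g h Yg Yh.
have : mmap polyC (curve_coord Phi) f * mmap polyC (curve_coord Phi) f' = 0.
  rewrite -rmorphM /=; apply: (poly_fun_eq0 char0) => r.
  rewrite -meval_curve mevalM.
  have : (A `|` B) (poly_rV Phi.[r%:P]) by rewrite -XE; exact: sub_closure.
  by case=> [/fA->|/f'B->]; rewrite ?mul0r ?mulr0.
move=> /eqP; rewrite mulf_eq0 => /orP[] /eqP E.
  by move: fg; rewrite gE meval_curve E horner0 eqxx.
by move: f'h; rewrite hE meval_curve E horner0 eqxx.
Qed.

End Zariski.

(** * A chain of length k at a polynomial with exactly k roots *)

Section ChainBelow.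
Variables (K : closedFieldType) (n : nat).
Hypothesis char0 : forall j : nat, j.+1%:R != 0 :> K.
Variables (l : nat) (s : nat -> K) (m : nat -> nat).
Hypothesis s_inj : injective (fun a : 'I_l => s a).
Hypothesis m_gt0 : forall a, (a < l)%N -> (0 < m a)%N.
Hypothesis sum_m : (\sum_(a < l) m a = n)%N.

Definition partly_moved (i : nat) : set 'rV[K]_n :=
  [set g | exists2 s' : nat -> K, (forall a, (i <= a)%N -> s' a = s a) &
     g = poly_rV (rprod l s' m)].

Lemma partly_moved_closure_irreducible i :
  irreducible_closed (zariski_closure (partly_moved i)).
Proof.
apply: (irreducible_closure_curves char0); first by exists (poly_rV (rprod l s m)), s.
move=> _ _ [s1 E1 ->] [s2 E2 ->].
exists (moving_roots l s1 (fun a => s2 a - s1 a) m), 0, 1; split.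
- move=> r; rewrite horner_moving_roots.
  exists (fun a => s1 a + r * (s2 a - s1 a)) => // a ia.
  by rewrite E1 // E2 // subrr mulr0 addr0.
- rewrite horner_moving_roots; congr poly_rV; apply: eq_bigr => a _.
  by rewrite mul0r addr0.
- rewrite horner_moving_roots; congr poly_rV; apply: eq_bigr => a _.
  by rewrite mul1r addrCA subrr addr0.
Qed.

Definition value_at (z : K) : {mpoly K[n]} :=
  (z ^+ n)%:MP + \sum_(i < n) z ^+ i *: 'X_i.

Lemma meval_value_at z (g : 'rV[K]_n) :
  (value_at z).@[g 0] = (monic_poly_of (g 0)).[z].
Proof.
rewrite /value_at mevalD mevalC hornerD hornerXn; congr (_ + _).
rewrite raddf_sum horner_sum; apply: eq_bigr => i _.
by rewrite /= mevalZ mevalXU hornerZ hornerXn mulrC.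
Qed.

(** The i-th set of the chain is the closure of the polynomials whose i first
    roots, with fixed multiplicities, are free. Evaluation at s_i vanishes on
    the i-th set, and does not on the next one. *)
Lemma chain_at_distinct : chain_at (Z K n l) (poly_rV (rprod l s m)) l.
Proof.
have mono i j : (i <= j)%N -> partly_moved i `<=` partly_moved j.
  move=> ij _ [s' Hs' ->]; exists s' => // a ja.
  by rewrite Hs' // (leq_trans ij).
exists (fun i => zariski_closure (partly_moved i)); split=> i il.
  split; first exact: partly_moved_closure_irreducible.
    by apply: sub_closure; exists s.
  apply: closure_sub; first exact: Z_algebraic.
  by move=> _ [s' _ ->]; apply: in_Z (leqnn l); exact: point_rprod.
split.
  apply: closure_sub; first exact: closure_algebraic.
  by apply: subset_trans (@sub_closure _ _ _); exact: mono.
move=> H.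
have [z zr] := exists_nonroot char0 (monic_neq0 (radical_monic l s)).
(* A polynomial of the next set whose moved roots are all away from s_i. *)
pose s' a := if (a <= i)%N then z else s a.
have Ys' : partly_moved i.+1 (poly_rV (rprod l s' m)).
  by exists s' => // a ia; rewrite /s' leqNgt ia.
have Iv : vanishing_ideal (partly_moved i) (value_at (s i)).
  move=> _ [s1 Hs1 ->]; rewrite meval_value_at point_rprod //; apply/eqP.
  by rewrite -(Hs1 i (leqnn i)); apply: (@rprod_root _ l s1 m (Ordinal il)); exact: m_gt0.
have /(_ _ Iv)/eqP := H _ (sub_closure Ys'); apply/negP.
rewrite meval_value_at point_rprod //.
rewrite horner_prod; apply/prodf_neq0 => a _; rewrite horner_exp expf_neq0 //.
rewrite hornerXsubC subr_eq0 /s'; case: leqP => ai.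
  apply: contra zr => /eqP <-; apply/eqP; exact: (horner_radical s (Ordinal il)).
apply/eqP => /(@s_inj (Ordinal il) a) E.
by move: ai; rewrite -E ltnn.
Qed.

End ChainBelow.


(** * Chains in Z_k have length at most k *)

Section Parametrization.
Variables (K : closedFieldType) (n : nat).

Lemma Z_param k (g : 'rV[K]_n) : (k <= n)%N -> Z K n k g ->
  exists (s : nat -> K) m, [/\ forall a, (a < k)%N -> (0 < m a)%N,
    (\sum_(a < k) m a = n)%N & monic_poly_of (g 0) = rprod k s m].
Proof.
move=> kn Zg.
have [l [s [m [si m0 sm E]]]] := exists_rprod_point g.
have lk : (l <= k)%N by rewrite -(Z_distinct k si m0 E).
have [|s' [m' [m'0 E']]] := rprod_splits (k := k) s m0; first by rewrite lk sm.
exists s', m'; split=> //; last by rewrite E.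
by have := size_rprod k s' m'; rewrite -E' size_rprod sm => -[].
Qed.

End Parametrization.

Section AlgebraicDependence.
Variable K : fieldType.

Lemma msizeM_bound k d e (p q : {mpoly K[k]}) :
  (msize p <= d.+1)%N -> (msize q <= e.+1)%N -> (msize (p * q)%R <= (d + e).+1)%N.
Proof.
move=> pd qe; have [->|p0] := eqVneq p 0; first by rewrite mul0r msize0.
have [->|q0] := eqVneq q 0; first by rewrite mulr0 msize0.
rewrite msizeM //; have := leq_add pd qe; rewrite addSn addnS.
by case: (_ + _)%N.
Qed.

Lemma msize_prod_bound k (I : finType) (G : I -> {mpoly K[k]}) d (e : I -> nat) N :
  (forall i, (msize (G i) <= d.+1)%N) -> (forall i, (e i <= N)%N) ->
  (msize (\prod_i G i ^+ e i)%R <= (#|I| * (N * d)).+1)%N.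
Proof.
move=> Gd eN; rewrite -sum_nat_const /index_enum.
elim/big_rec2: _ => [|i D p _ IH]; first by rewrite msize1.
apply: msizeM_bound => //.
have H j : (msize (G i ^+ j)%R <= (j * d).+1)%N.
  elim: j => [|j IHj]; first by rewrite expr0 msize1.
  by rewrite exprS mulSn; apply: msizeM_bound.
by rewrite (leq_trans (H _)) // ltnS leq_mul2r eN orbT.
Qed.

(** The monomials in the k + 1 polynomials with exponents less than N are
    N^(k+1) in number and lie in a space of dimension at most (C N + 1)^k for a
    constant C, so they are linearly dependent for N large. *)
Lemma algebraic_dependence k (G : 'I_k.+1 -> {mpoly K[k]}) :
  exists N (c : {ffun 'I_k.+1 -> 'I_N} -> K), (exists m, c m != 0) /\
  \sum_m c m *: \prod_(j < k.+1) G j ^+ m j = 0.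
Proof.
pose d := (\max_(j < k.+1) msize (G j))%N.
have Gd j : (msize (G j) <= d.+1)%N.
  by rewrite ltnW // ltnS; apply: (leq_bigmax j).
(* With this N, (M + 1)^k <= (N E)^k = N^k E^k < N^(k+1). *)
pose E := (k.+1 * d).+1; pose N := (E ^ k).+1; pose M := (k.+1 * (N * d))%N.
pose I : finType := {ffun 'I_k.+1 -> 'I_N}.
pose J : finType := {ffun 'I_k -> 'I_M.+1}.
have JI : (#|J| < #|I|)%N.
  rewrite !card_ffun !card_ord [ltnRHS]expnS.
  apply: (@leq_ltn_trans ((N * E) ^ k)%N).
    have le_exp a b e : (a <= b -> a ^ e <= b ^ e)%N.
      by move=> ab; elim: e => [|e IHe]; rewrite ?expn0 // !expnS leq_mul.
    apply: le_exp; rewrite /M /E mulnS mulnCA addnC.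
    by rewrite -addn1 leq_add2l.
  by rewrite expnMn mulnC ltn_pmul2r // expn_gt0.
pose mono (a : J) : 'X_{1..k} := [multinom (a i : nat) | i < k].
pose A := \matrix_(i < #|I|, j < #|J|)
  (\prod_(b < k.+1) G b ^+ (enum_val i : I) b)@_(mono (enum_val j)).
have /rowV0Pn[v /sub_kermxP vA v0] : kermx A != 0.
  rewrite kermx_eq0; apply: contraL JI => /eqP rA.
  by rewrite -leqNgt -{1}rA rank_leq_col.
exists N, (fun m : I => v 0 (enum_rank m)); split.
  apply: contrapT => H; move: v0 => /eqP; apply; apply/rowP => i; rewrite mxE.
  apply/eqP; apply: contrapT => /negP vi; apply: H.
  by exists (enum_val i); rewrite enum_valK.
apply/mpolyP => u; rewrite mcoeff0 raddf_sum /=.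
have [uM|Mu] := leqP (mdeg u) M; last first.
  rewrite big1 // => m _; rewrite mcoeffZ memN_msupp_eq0 ?mulr0 //.
  apply: msize_mdeg_ge; apply: leq_trans Mu.
  have := @msize_prod_bound k _ G d (fun j => m j) N Gd.
  by rewrite card_ord; apply=> i; exact: ltnW.
pose a : J := [ffun i => inord (u i)].
have aE : mono a = u.
  apply/mnmP => i; rewrite mnmE ffunE inordK // ltnS (leq_trans _ uM) //.
  by rewrite mdegE (bigD1 i) //= leq_addr.
have /rowP/(_ (enum_rank a)) := vA; rewrite !mxE => vAa; rewrite -[RHS]vAa {vAa}.
rewrite (reindex (@enum_val I predT)); last first.
  by exists enum_rank => i _; [exact: enum_valK|exact: enum_rankK].
apply: eq_big => // i _.
by rewrite mcoeffZ mxE enum_rankK aE enum_valK.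
Qed.

End AlgebraicDependence.

Section ChainAbove.
Variables (K : closedFieldType) (n : nat).
Hypothesis char0 : forall j : nat, j.+1%:R != 0 :> K.

Section Independence.
Variables (e N : nat) (X : nat -> set 'rV[K]_n) (f : 'I_e -> {mpoly K[n]}).
Hypothesis X_irr : forall i, (i <= e)%N -> irreducible_closed (X i).
Hypothesis X_sub : forall i : 'I_e, X i `<=` X i.+1.
Hypothesis f_vanish : forall i : 'I_e, vanishing_ideal (X i) (f i).
Hypothesis f_nvanish : forall i : 'I_e, ~ vanishing_ideal (X i.+1) (f i).
Variable c : {ffun 'I_e -> 'I_N} -> K.

(** A relation on X_{i+1} between the f_j with j <= i is divided by the highest
    power of f_i that divides all its monomials, which is allowed as f_i is
    nonzero on the irreducible X_{i+1}. Restriction to X_i, where f_i vanishes,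
    then leaves the terms of lowest degree in f_i, which form a relation between
    the f_j with j < i. The exponents of the surviving terms agree from the index
    i on, so that distinct exponents remain distinct monomials. *)
Lemma chain_independent_step i (S : {set {ffun 'I_e -> 'I_N}}) :
  (i <= e)%N -> S != finset.set0 -> {in S, forall m, c m != 0} ->
  {in S &, forall m m' : {ffun 'I_e -> 'I_N}, forall j : 'I_e,
    (i <= j)%N -> m j = m' j} ->
  ~ vanishing_ideal (X i)
      (\sum_(m in S) c m *: \prod_(j < e | (j < i)%N) f j ^+ m j).
Proof.
elim: i S => [|i IH] S ie /finset.set0Pn[m0 Sm0] cS agree.
  have [_ [g Xg] _] := X_irr ie => /(_ g Xg)/eqP.
  rewrite (big_pred1 m0) => [|m]; last first.
    apply/idP/eqP => [Sm|->//]; apply/ffunP => j; exact: agree.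
  by rewrite big_pred0 // mevalZ meval1 mulr1 (negbTE (cS _ Sm0)).
pose o := Ordinal ie.
case: (arg_minnP (fun m : {ffun 'I_e -> 'I_N} => m o : nat) Sm0) => m1 Sm1' min1.
have Sm1 : m1 \in S by exact: Sm1'.
pose S' := [set m in S | m o == m1 o]%SET.
have prodE m : \prod_(j < e | (j < i.+1)%N) f j ^+ m j =
    f o ^+ m o * \prod_(j < e | (j < i)%N) f j ^+ m j.
  rewrite (bigD1 o) //=; congr (_ * _); apply: eq_bigl => j.
  by rewrite ltnS -val_eqE /= ltn_neqAle andbC.
set G := \sum_(m in S) c m *:
  (f o ^+ (m o - m1 o) * \prod_(j < e | (j < i)%N) f j ^+ m j).
rewrite (_ : \sum_(m in S) _ = f o ^+ m1 o * G); last first.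
  rewrite mulr_sumr; apply: eq_bigr => m Sm; rewrite prodE -scalerAr mulrA.
  by rewrite -exprD subnKC // min1.
move=> /(irreducible_prime (X_irr ie))[If|IG].
  apply: (@f_nvanish o) => g Xg; have /eqP := If g Xg.
  by rewrite rmorphXn /= expf_eq0 => /andP[_ /eqP].
apply: (IH S') => [||m|m m'|g Xg].
- exact: ltnW.
- by apply/finset.set0Pn; exists m1; rewrite inE Sm1 eqxx.
- by rewrite inE => /andP[Sm _]; exact: cS.
- rewrite !inE => /andP[Sm /eqP mo] /andP[Sm' /eqP m'o] j.
  rewrite leq_eqVlt => /orP[/eqP ij|]; last exact: agree.
  have -> : j = o by exact: val_inj.
  by rewrite mo.
have := IG g (X_sub (i := o) Xg); rewrite /G !raddf_sum /= => H.
rewrite -[RHS]H [RHS](bigID (fun m : {ffun _} => m o == m1 o)) /=.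
rewrite [X in _ + X]big1 ?addr0 => [|m /andP[Sm mo]].
  apply: eq_big => m; first by rewrite inE.
  by rewrite inE => /andP[_ /eqP->]; rewrite subnn expr0 mul1r.
rewrite mevalZ mevalM rmorphXn /= (f_vanish (i := o) Xg) expr0n.
rewrite subn_eq0 leqNgt ltn_neqAle (min1 m Sm) andbT eq_sym.
by rewrite (_ : (m o == m1 o :> nat) = false) ?mul0r ?mulr0 //; apply/negbTE.
Qed.

Lemma chain_independent m : c m != 0 ->
  ~ vanishing_ideal (X e) (\sum_m c m *: \prod_(j < e) f j ^+ m j).
Proof.
move=> cm H; pose S := [set m | c m != 0]%SET.
apply: (@chain_independent_step e S (leqnn e)) => [|m'|m1 m2 _ _ j|].
- by apply/finset.set0Pn; exists m; rewrite inE.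
- by rewrite inE.
- by rewrite leqNgt ltn_ord.
move=> g Xg; rewrite -[RHS](H g Xg); congr (_.@[_]).
rewrite [RHS](bigID (fun m => m \in S)) /= [X in _ + X]big1 ?addr0.
  by apply: eq_bigr => m' _; congr (_ *: _); apply: eq_bigl => j; rewrite ltn_ord.
by move=> m'; rewrite inE negbK => /eqP->; rewrite scale0r.
Qed.

End Independence.

(** For each distribution mm of multiplicities the f_i become k + 1 polynomials
    in the k roots, hence satisfy a relation h mm on the corresponding part of
    Z_k. The product of these relations vanishes on Z_k, so one of the factors
    vanishes on X_{k+1}, against independence. *)
Lemma chain_length_le k p e : (k <= n)%N -> chain_at (Z K n k) p e -> (e <= k)%N.
Proof.
move=> kn [X [HX sX]]; rewrite leqNgt; apply/negP => ke.
have Xirr i : (i <= k.+1)%N -> irreducible_closed (X i).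
  by move=> ik; have [] := HX i (leq_trans ik ke).
have lt_e (i : 'I_k.+1) : (i < e)%N by exact: leq_trans ke.
have Xsub (i : 'I_k.+1) : X i `<=` X i.+1 by have [] := sX i (lt_e i).
have /choice[f Hf] : forall i : 'I_k.+1, exists fi,
    vanishing_ideal (X i) fi /\ ~ vanishing_ideal (X i.+1) fi.
  move=> i; have [_ nsub] := sX i (lt_e i).
  apply: contrapT => H; apply: nsub => g Xg.
  have [alg _ _] := Xirr i (ltnW (ltn_ord i)).
  apply: contrapT => /(algebraic_sep alg)[fi Ifi fig]; apply: H.
  by exists fi; split=> // H; move: fig; rewrite (H g Xg) eqxx.
pose T (mm : {ffun 'I_k -> 'I_n.+1}) : {poly {mpoly K[k]}} :=
  \prod_(a < k) ('X - ('X_a : {mpoly K[k]})%:P) ^+ mm a.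
pose q mm (i : 'I_n) : {mpoly K[k]} := (T mm)`_i.
have qE (mm : {ffun 'I_k -> 'I_n.+1}) (s : nat -> K) (h : {mpoly K[n]}) :
    h.@[(poly_rV (\prod_(a < k) ('X - (s a)%:P) ^+ mm a) : 'rV_n) 0] =
    (mmap (@mpolyC k K) (q mm) h).@[fun a => s a].
  have TE : map_poly (meval (fun a : 'I_k => s a)) (T mm) =
      \prod_(a < k) ('X - (s a)%:P) ^+ mm a.
    rewrite rmorph_prod /=; apply: eq_bigr => a _.
    by rewrite rmorphXn rmorphB /= map_polyX map_polyC /= mevalXU.
  elim/mpoly_ring_ind: h => [c|i|f1 f2 P1 P2|f1 f2 P1 P2].
  - by rewrite mmapC !mevalC.
  - by rewrite mmapX mmap1U mevalXU mxE /q -(coef_map (meval (fun a : 'I_k => s a))) TE.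
  - by rewrite !raddfD /= P1 P2.
  - by rewrite !rmorphM /= P1 P2.
have dep mm := algebraic_dependence (fun j => mmap (@mpolyC k K) (q mm) (f j)).
have /choice[h Hh] : forall mm : {ffun 'I_k -> 'I_n.+1}, exists h : {mpoly K[n]},
    ~ vanishing_ideal (X k.+1) h /\ mmap (@mpolyC k K) (q mm) h = 0.
  move=> mm; have [N [c [[m cm] E]]] := dep mm.
  exists (\sum_m c m *: \prod_(j < k.+1) f j ^+ m j); split.
    apply: (chain_independent Xirr Xsub _ _ cm) => i; first exact: (Hf i).1.
    exact: (Hf i).2.
  rewrite -[RHS]E raddf_sum /=; apply: eq_bigr => m' _.
  rewrite mmapZ mul_mpolyC rmorph_prod; congr (_ *: _).
  by apply: eq_bigr => j _; rewrite rmorphXn.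
have [_ _ XZ] := HX k.+1 ke.
have [mm /(Hh mm).1//] : exists mm : {ffun 'I_k -> 'I_n.+1},
  vanishing_ideal (X k.+1) (h mm).
apply: irreducible_prime_prod; first exact: Xirr.
move=> g /XZ/(Z_param kn)[s [m [m0 sm E]]].
have mn (a : 'I_k) : (m a < n.+1)%N by rewrite ltnS -sm (bigD1 a) //= leq_addr.
pose mm := [ffun a : 'I_k => Ordinal (mn a)].
rewrite (bigD1 mm) //= mevalM (_ : (h mm).@[g 0] = 0) ?mul0r //.
rewrite -(poly_rV_monic_poly_of g) E /rprod.
have -> : \prod_(a < k) ('X - (s a)%:P) ^+ m a =
    \prod_(a < k) ('X - (s a)%:P) ^+ mm a.
  by apply: eq_bigr => a _; rewrite ffunE.
by rewrite qE (Hh mm).2 meval0.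
Qed.

End ChainAbove.

(** * Cusps obtained by splitting a repeated root *)

Section Cusp.
Variables (K : closedFieldType) (n : nat).
Hypothesis char0 : forall j : nat, j.+1%:R != 0 :> K.

Lemma coef_exp_subX (A : comNzRingType) (c : A) N j :
  ((c%:P - 'X) ^+ N)`_j = (-1) ^+ j * c ^+ (N - j) *+ 'C(N, j).
Proof.
have E i : (((-1) ^+ i * c%:P ^+ (N - i) * 'X^i *+ 'C(N, i)) : {poly A})`_j =
    if j == i then (-1) ^+ i * c ^+ (N - i) *+ 'C(N, i) else 0.
  rewrite -polyC_exp -(polyCN 1) -polyC_exp -polyCM coefMn coefCM coefXn.
  by case: eqP; rewrite ?mulr1 // mulr0 mul0rn.
rewrite exprBn coef_sum (eq_bigr (fun i : 'I_N.+1 => if j == i then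
  (-1) ^+ i * c ^+ (N - i) *+ 'C(N, i) else 0) (fun i _ => E i)).
have [jN|Nj] := ltnP j N.+1; last first.
  rewrite bin_small // mulr0n big1 // => i _.
  by rewrite gtn_eqF // (leq_trans (ltn_ord i)).
rewrite (bigD1 (Ordinal jN)) //= eqxx big1 ?addr0 // => i ij.
by rewrite eq_sym -[j]/(val (Ordinal jN)) val_eqE (negbTE ij).
Qed.

Lemma bin2_lt N : (0 < N)%N -> ('C(N, 2) < N * N)%N.
Proof.
case: N => // N _; rewrite bin2 /= (@leq_ltn_trans (N.+1 * N)) //.
  by rewrite -divn2 leq_div.
by rewrite ltn_pmul2l.
Qed.

Lemma bin3_lt N : (1 < N)%N -> ('C(N, 3) < N * 'C(N, 2))%N.
Proof.
move=> N1; have B2 : (0 < 'C(N, 2))%N by rewrite bin_gt0.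
rewrite -(ltn_pmul2l (m := 3)) // mul_bin_left mulnA ltn_pmul2r //.
by rewrite (@leq_ltn_trans N) ?leq_subr // -{1}[N]mul1n ltn_pmul2r // ltnW.
Qed.

Section RepeatedRoot.
Variables (l : nat) (s : nat -> K) (m : nat -> nat).
Hypothesis m_gt0 : forall a, (a < l)%N -> (0 < m a)%N.
Hypothesis sum_m : (\sum_(a < l) m a = n)%N.
Variables (r : 'I_l) (N : nat).
Hypothesis m_r : m r = N.+1.
Let g : 'rV[K]_n := poly_rV (rprod l s m).
Let rest : {poly K} := \prod_(b < l | (b : nat) != r) ('X - (s b)%:P) ^+ m b.
Let x : {poly K} := 'X - (s r)%:P.

Lemma rprod_rest : rprod l s m = rest * x ^+ N.+1.
Proof. by rewrite /rprod (bigD1 r) //= -/x m_r mulrC. Qed.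

(** The root s_r of multiplicity N + 1 splits into s_r + t, taken N times, and
    s_r - N t: the centre of mass does not move, so the velocity is zero, and
    only one root is added. *)
Definition cusp : {poly {poly K}} :=
  rest%:P * ((x%:P - 'X) ^+ N * (x%:P + N%:R *: 'X)).

Lemma horner_cusp t : cusp.[t%:P] =
  rest * (('X - (s r + t)%:P) ^+ N * ('X - (s r - N%:R * t)%:P)).
Proof.
rewrite /cusp hornerM hornerC; congr (_ * _); rewrite hornerM horner_exp.
congr (_ ^+ _ * _).
  by rewrite hornerD hornerN hornerX hornerC polyCD opprD addrA.
rewrite hornerD hornerZ hornerX hornerC !rmorphB /= opprB addrCA addrC.
by rewrite rmorphM /= polyC_natr.
Qed.

Lemma cusp_in_Z k : (l < k)%N -> forall t, Z K n k (poly_rV cusp.[t%:P]).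
Proof.
move=> lk t; rewrite horner_cusp.
set p := rest * _.
have rest_monic : rest \is monic.
  by apply: monic_prod => a _; apply: monic_exp; exact: monicXsubC.
have pm : p \is monic by rewrite !rpredM // ?monic_exp ?monicXsubC.
have sp : size p = n.+1.
  have := size_rprod l s m; rewrite sum_m rprod_rest => <-.
  rewrite /p !size_monicM ?monic_neq0 ?monic_exp ?monicXsubC //; last first.
    by rewrite monicMl ?monic_exp ?monicXsubC.
  by rewrite !size_exp_XsubC size_XsubC addn2.
apply: (@in_Z_roots _ _ ((s r - N%:R * t) ::
   [seq (if a == r then s r + t else s a) | a : 'I_l <- enum 'I_l])); last first.
  by rewrite /= size_map size_enum_ord.
move=> z; rewrite monic_poly_of_poly_rV // /p !rootM inE.
case/orP=> [|/orP[]].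
- rewrite /root horner_prod => /prodf_eq0[a ar].
  rewrite horner_exp hornerXsubC expf_eq0 subr_eq0 => /andP[_ /eqP ->].
  apply/orP; right; apply/mapP; exists a; rewrite ?mem_enum //.
  by rewrite -val_eqE /= (negbTE ar).
- rewrite /root horner_exp hornerXsubC expf_eq0 subr_eq0 => /andP[_ /eqP ->].
  by apply/orP; right; apply/mapP; exists r; rewrite ?mem_enum ?eqxx.
- by rewrite root_XsubC => ->.
Qed.

Lemma coef_cusp j : cusp`_j.+1 = rest *
  (((x%:P - 'X) ^+ N)`_j.+1 * x + ((x%:P - 'X) ^+ N)`_j *+ N).
Proof.
rewrite /cusp coefCM; congr (_ * _); rewrite mulrDr coefD coefMC; congr (_ + _).
by rewrite scaler_nat mulrnAr coefMn coefMX.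
Qed.

Lemma coef0_cusp : cusp`_0 = rprod l s m.
Proof.
rewrite rprod_rest /cusp coefCM; congr (_ * _); rewrite mulrDr coefD coefMC.
rewrite coef_exp_subX expr0 mul1r subn0 bin0 mulr1n -exprSr.
by rewrite scaler_nat mulrnAr coefMn coefMX mul0rn addr0.
Qed.

Lemma coef1_cusp : cusp`_1 = 0.
Proof.
rewrite coef_cusp !coef_exp_subX bin0 bin1 subn0 expr0 mul1r mulr1n.
have [->|N0] := posnP N; first by rewrite !mulr0n mul0r addr0 mulr0.
rewrite mulrnAl expr1 mulN1r mulNr -exprSr subn1 prednK // mulNrn addNr.
by rewrite mulr0.
Qed.

Hypothesis N_gt0 : (0 < N)%N.

Lemma tangent_double k : (l < k)%N ->
  tangent_space (Z K n k) g (poly_rV (rest * x ^+ N.-1)).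
Proof.
move=> lk; have [+ _] := tangent_cusp char0 (cusp_in_Z lk) coef1_cusp.
rewrite coef0_cusp -/g => T2.
(* The coefficient of t^2 is a multiple of F / ('X - s_r)^2 by this factor. *)
pose a : K := ('C(N, 2))%:R - (N * N)%:R.
have a0 : a != 0.
  by rewrite subr_eq0 (inj_eq (natr_inj0 char0)) ltn_eqF // bin2_lt.
rewrite (_ : poly_rV _ = a^-1 *: poly_rV cusp`_2); first exact: tangentZ.
rewrite -linearZ /=; congr poly_rV.
apply: (canRL (scalerK a0)).
rewrite coef_cusp !coef_exp_subX bin1 expr1 sqrrN expr1n mul1r mulN1r subn1.
rewrite scalerAr; congr (_ * _).
rewrite !mulNrn -mulrnA /a scalerBl !scaler_nat; congr (_ - _).
have [N1|N1] := leqP N 1; first by rewrite bin_small // !mulr0n mul0r.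
rewrite mulrnAl -exprSr; congr (_ ^+ _ *+ _).
by rewrite subn2; case: (N) N1 => [|[]].
Qed.

Lemma tangent_triple k : (1 < N)%N -> (l < k)%N ->
  tangent_space (Z K n k) g (poly_rV (rest * x ^+ N.-2)).
Proof.
move=> N1 lk; have [_ +] := tangent_cusp char0 (cusp_in_Z lk) coef1_cusp.
rewrite coef0_cusp -/g => T3.
(* The coefficient of t^3 is a multiple of F / ('X - s_r)^3 by this factor. *)
pose a : K := (N * 'C(N, 2))%:R - ('C(N, 3))%:R.
have a0 : a != 0.
  by rewrite subr_eq0 (inj_eq (natr_inj0 char0)) gtn_eqF // bin3_lt.
rewrite (_ : poly_rV _ = a^-1 *: poly_rV cusp`_3); first exact: tangentZ.
rewrite -linearZ /=; congr poly_rV.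
apply: (canRL (scalerK a0)).
rewrite coef_cusp !coef_exp_subX sqrrN expr1n mul1r.
rewrite exprS sqrrN expr1n mulr1 mulN1r subn2.
rewrite scalerAr; congr (_ * _).
rewrite -mulrnA /a scalerBl !scaler_nat mulNrn mulNr mulrnAl [RHS]addrC.
rewrite [('C(N, 2) * N)%N]mulnC; congr (_ - _).
have [N2|N2] := leqP N 2; first by rewrite bin_small // !mulr0n.
rewrite -exprSr; congr (_ ^+ _ *+ _).
by case: (N) N2 => [|[|[|N']]] //= _; rewrite !subSS subn0.
Qed.

End RepeatedRoot.
End Cusp.

(** * Excess of tangent vectors at a polynomial with k - 1 roots *)

Section ExtraTangents.
Variables (K : closedFieldType) (n : nat).
Hypothesis char0 : forall j : nat, j.+1%:R != 0 :> K.
Variables (l : nat) (s : nat -> K) (m : nat -> nat).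
Hypothesis s_inj : injective (fun a : 'I_l => s a).
Hypothesis m_gt0 : forall a, (a < l)%N -> (0 < m a)%N.
Hypothesis sum_m : (\sum_(a < l) m a = n)%N.
Let F := rprod l s m.
Let g : 'rV[K]_n := poly_rV F.
Let rest (r : 'I_l) : {poly K} :=
  \prod_(b < l | (b : nat) != r) ('X - (s b)%:P) ^+ m b.
Let x (r : 'I_l) : {poly K} := 'X - (s r)%:P.

Lemma linear_factor_neq0 r : x r != 0.
Proof. by rewrite polyXsubC_eq0. Qed.

(** If all multiplicities are at most 2, a single double root would make the
    degree at most l + 1. *)
Lemma two_double_roots : (l.+2 <= n)%N -> ~ (exists r : 'I_l, (2 < m r)%N) ->
  exists r t : 'I_l, [/\ r != t, (1 < m r)%N & (1 < m t)%N].
Proof.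
move=> ln m3.
have [|r _ mr] := @exists_gt1 'I_l predT (fun a => m a).
  by rewrite sum1_card card_ord sum_m ltnW.
have mr2 : (m r <= 2)%N.
  by rewrite leqNgt; apply/negP => H; apply: m3; exists r.
have [|t tr mt] := @exists_gt1 'I_l (predC1 r) (fun a => m a).
  have l1 : l = (1 + \sum_(i < l | i != r) 1)%N.
    by rewrite -[in LHS](card_ord l) -sum1_card (bigD1 r).
  rewrite -(ltn_add2l 2) (_ : 2 + _ = l.+1)%N; last by rewrite [in RHS]l1.
  apply: leq_trans ln _; rewrite -sum_m (bigD1 r) //=.
  by rewrite leq_add2r.
by exists r, t; split; rewrite // eq_sym.
Qed.

Lemma row_free_extra (u1 u2 : {poly K}) :
  (size u1 <= n)%N -> (size u2 <= n)%N ->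
  (forall (c : 'I_l -> K) a b,
     rgcd l s m * (\sum_(i < l) c i *: cofactor_at l s i)
       + a *: u1 + b *: u2 = 0 ->
     [/\ a = 0, b = 0 & \sum_(i < l) c i *: cofactor_at l s i = 0]) ->
  row_free (col_mx (cofactor_mx n l s m)
    (col_mx (poly_rV u1 : 'rV_n) (poly_rV u2 : 'rV_n))).
Proof.
move=> s1 s2 ind; apply: inj_row_free => v.
rewrite -[v]hsubmxK mul_row_col -[rsubmx v]hsubmxK mul_row_col.
set c := lsubmx v; set a := lsubmx _; set b := rsubmx (rsubmx v).
rewrite mul_cofactor_mx [a]mx11_scalar [b]mx11_scalar !mul_scalar_mx.
rewrite -!linearZ -!linearD /= => /(congr1 rVpoly); rewrite linear0 poly_rV_K.
  rewrite addrA => /ind[a0 b0 /(cofactor_free s_inj) c0].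
  rewrite a0 b0 !raddf0 row_mx0.
  have -> : c = 0 by apply/rowP => i; rewrite c0 mxE.
  by rewrite row_mx0.
rewrite (leq_trans (size_polyD _ _)) // geq_max size_rgcd_mul //=; last first.
  apply: (leq_trans (size_sum _ _ _)); apply/bigmax_leqP => i _.
  by rewrite (leq_trans (size_scale_leq _ _)) // size_cofactor.
rewrite (leq_trans (size_polyD _ _)) // geq_max.
by rewrite !(leq_trans (size_scale_leq _ _)).
Qed.

Lemma size_rest_mul (r : 'I_l) j : (j < m r)%N -> (size (rest r * x r ^+ j)%R <= n)%N.
Proof.
move=> jm; have rest_monic : rest r \is monic.
  by apply: monic_prod => a _; apply: monic_exp; exact: monicXsubC.
have := size_rprod l s m; rewrite sum_m /rprod (bigD1 r) //= mulrC -/(rest r).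
rewrite !size_monicM ?monic_neq0 ?monic_exp ?monicXsubC //.
rewrite !size_exp_XsubC !addnS /= => E.
by rewrite -ltnS -E ltn_add2l.
Qed.

Lemma rest_factor (r : 'I_l) j G e :
  rgcd l s m * (x r * cofactor_at l s r) = G * x r ^+ e ->
  (j + e = m r)%N -> rest r * x r ^+ j = G.
Proof.
move=> E je; apply: (mulIf (expf_neq0 e (linear_factor_neq0 r))).
rewrite -mulrA -exprD je -E -radicalE -rprod_rgcd //.
by rewrite /rprod (bigD1 r) //= mulrC.
Qed.

(** The tangents F / ('X - s_a) are completed by F / ('X - s_r)^2 and
    F / ('X - s_r)^3 if s_r is at least triple, and otherwise by
    F / ('X - s_r)^2 and F / ('X - s_t)^2 for two double roots. Up to a common
    factor G these are polynomials that are separated by evaluating at the roots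
    s_r and s_t. *)
Lemma extra_tangents k : (l.+2 <= n)%N -> (l < k)%N ->
  exists B : 'M[K]_(l + (1 + 1), n),
    row_free B /\ forall i, tangent_space (Z K n k) g (row i B).
Proof.
move=> ln lk.
have key (u1 u2 : {poly K}) : tangent_space (Z K n k) g (poly_rV u1) ->
    tangent_space (Z K n k) g (poly_rV u2) -> forall i,
    tangent_space (Z K n k) g (row i (col_mx (cofactor_mx n l s m)
    (col_mx (poly_rV u1 : 'rV_n) (poly_rV u2 : 'rV_n)))).
  move=> T1 T2 i; case: (split_ordP i) => [a ->|b ->].
    by rewrite rowKu rowK; apply: tangent_cofactor => //; exact: ltnW.
  by rewrite rowKd; case: (split_ordP b) => [a ->|a ->];
    rewrite ?rowKu ?rowKd row_id.
have [[r mr]|H] := pselect (exists r : 'I_l, (2 < m r)%N).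
  have mrE : m r = (m r).-1.+1 by rewrite prednK // ltnW // ltnW.
  have N1 : (1 < (m r).-1)%N by rewrite -ltnS -mrE.
  pose u1 := rest r * x r ^+ (m r).-1.-1.
  pose u2 := rest r * x r ^+ (m r).-1.-2.
  exists (col_mx (cofactor_mx n l s m) (col_mx (poly_rV u1) (poly_rV u2))).
  split; last first.
    apply: key; last exact: tangent_triple N1 lk.
    by apply: tangent_double mrE (ltnW N1) _ lk.
  apply: row_free_extra.
  - by apply: size_rest_mul; case: (m r) mr => [|[]].
  - apply: size_rest_mul; case: (m r) mr => [|[|[|m']]] //= _.
    exact: leqW (leqW (leqnn _)).
  move=> c a b.
  have [G QE] : exists G, rgcd l s m = G * x r ^+ 2.
    apply/dvdpP; rewrite /rgcd /rprod (bigD1 r) //=.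
    by apply: dvdp_mulr; exact: dvdp_exp2l.
  have u1E : u1 = G * (x r * cofactor_at l s r).
    apply: (@rest_factor r _ _ 2); last first.
      by case: (m r) mr => [|[|m']] //= _; rewrite addn2.
    by rewrite QE; ring.
  have u2E : u2 = G * cofactor_at l s r.
    apply: (@rest_factor r _ _ 3).
      by rewrite QE; ring.
    by case: (m r) mr => [|[|[|m']]] //= _; rewrite addn3.
  set D := \sum_(i < l) _.
  rewrite u1E u2E QE -mulrA !scalerAr -!mulrDr => /eqP.
  have G0 : G != 0.
    by apply: contraNneq (rgcd_neq0 l s m) => G0; rewrite QE G0 mul0r.
  rewrite mulf_eq0 (negbTE G0) => /eqP E.
  have cof0 := horner_cofactor_neq0 s_inj r.
  have xr : (x r).[s r] = 0 by rewrite /x hornerXsubC subrr.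
  have b0 : b = 0.
    have /eqP := congr1 (horner^~ (s r)) E.
    rewrite /= 2!hornerD [(_ * D).[_]]hornerM horner_exp [(x r * _).[_]]hornerM
      2!hornerZ xr expr0n !mul0r.
    by rewrite !add0r horner0 mulf_eq0 (negbTE cof0) orbF => /eqP.
  move: E; rewrite b0 scale0r addr0 exprS -mulrA -mulrDr => /eqP.
  rewrite mulf_eq0 (negbTE (linear_factor_neq0 r)) expr1 => /eqP E.
  have a0 : a = 0.
    have /eqP := congr1 (horner^~ (s r)) E.
    rewrite /= hornerD hornerM hornerZ xr mul0r.
    by rewrite !add0r horner0 mulf_eq0 (negbTE cof0) orbF => /eqP.
  split=> //; move/eqP: E; rewrite a0 scale0r addr0 mulf_eq0.
  by rewrite (negbTE (linear_factor_neq0 r)) => /eqP.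
have [r [t [rt mr mt]]] := two_double_roots ln H.
pose u1 := rest r * x r ^+ (m r).-1.-1.
pose u2 := rest t * x t ^+ (m t).-1.-1.
exists (col_mx (cofactor_mx n l s m) (col_mx (poly_rV u1) (poly_rV u2))).
have E1 (a : 'I_l) : (1 < m a)%N -> m a = (m a).-1.+1 /\ (0 < (m a).-1)%N.
  by case: (m a) => [|[]].
split; last first.
  apply: key.
    by apply: tangent_double (E1 r mr).1 (E1 r mr).2 _ lk.
  by apply: tangent_double (E1 t mt).1 (E1 t mt).2 _ lk.
apply: row_free_extra.
- by apply: size_rest_mul; case: (m r) mr => [|[]].
- by apply: size_rest_mul; case: (m t) mt => [|[]].
move=> c a b.
have [G QE] : exists G, rgcd l s m = G * (x r * x t).
  apply/dvdpP; rewrite /rgcd /rprod (bigD1 r) //= (bigD1 t) 1?eq_sym //= mulrA.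
  apply: dvdp_mulr; apply: dvdp_mul.
    by rewrite -[X in X %| _]expr1; apply: dvdp_exp2l; exact: (E1 r mr).2.
  by rewrite -[X in X %| _]expr1; apply: dvdp_exp2l; exact: (E1 t mt).2.
have u1E : u1 = G * (x t * cofactor_at l s r).
  apply: (@rest_factor r _ _ 2); last first.
      by case: (m r) mr => [|[|m']] //= _; rewrite addn2.
  by rewrite QE; ring.
have u2E : u2 = G * (x r * cofactor_at l s t).
  apply: (@rest_factor t _ _ 2); last first.
    by case: (m t) mt => [|[|m']] //= _; rewrite addn2.
  by rewrite QE; ring.
set D := \sum_(i < l) _.
rewrite u1E u2E QE -mulrA !scalerAr -!mulrDr => /eqP.
have G0 : G != 0.
  by apply: contraNneq (rgcd_neq0 l s m) => G0; rewrite QE G0 mul0r.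
rewrite mulf_eq0 (negbTE G0) => /eqP E.
have xx (a1 : 'I_l) : (x a1).[s a1] = 0 by rewrite /x hornerXsubC subrr.
have xy (a1 b1 : 'I_l) : a1 != b1 -> (x a1).[s b1] != 0.
  rewrite /x hornerXsubC subr_eq0; apply: contra => /eqP/(@s_inj b1 a1)->.
  exact: eqxx.
have a0 : a = 0.
  have /eqP := congr1 (horner^~ (s r)) E.
  rewrite /= 2!hornerD 4!hornerM 2!hornerZ xx ?mulr0 !mul0r add0r addr0 horner0.
  rewrite !mulf_eq0 (negbTE (horner_cofactor_neq0 s_inj r)).
  by rewrite (negbTE (xy t r _)) 1?eq_sym // !orbF => /eqP.
have b0 : b = 0.
  have /eqP := congr1 (horner^~ (s t)) E.
  rewrite /= 2!hornerD 4!hornerM 2!hornerZ xx ?mulr0 !mul0r !add0r horner0.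
  rewrite !mulf_eq0 (negbTE (horner_cofactor_neq0 s_inj t)).
  by rewrite (negbTE (xy r t _)) // !orbF => /eqP.
split=> //; move/eqP: E; rewrite a0 b0 !scale0r !mulr0 !addr0 !mulf_eq0.
by rewrite (negbTE (linear_factor_neq0 r)) (negbTE (linear_factor_neq0 t)) => /eqP.
Qed.

End ExtraTangents.

(** * Semicontinuity of the tangent dimension *)

Section Semicontinuity.
Variables (K : closedFieldType) (n : nat).
Hypothesis char0 : forall j : nat, j.+1%:R != 0 :> K.
Variable W : set 'rV[K]_n.

Definition jacobian r (f : 'I_r -> {mpoly K[n]}) (g : 'rV[K]_n) : 'M[K]_(r, n) :=
  \matrix_(i < r, j < n) (f i)^`M(j).@[g 0].

Lemma row_free_col_mx r (A : 'M[K]_(r, n)) (v : 'rV_n) :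
  row_free A -> ~~ (v <= A)%MS -> row_free (col_mx A v).
Proof.
move=> freeA nvA; apply: inj_row_free => u.
rewrite -[u]hsubmxK mul_row_col; set a := lsubmx u.
rewrite [rsubmx u]mx11_scalar mul_scalar_mx; set b := rsubmx u 0 0.
have [->|b0] := eqVneq b 0.
  rewrite scale0r addr0 -[0 in X in X -> _](mul0mx _ A) => /(row_free_inj freeA)->.
  by rewrite raddf0 row_mx0.
move=> /eqP; rewrite addrC addr_eq0 => /eqP E; case/negP: nvA.
apply/submxP; exists (- b^-1 *: a); rewrite -scalemxAl scaleNr -scalerN -E.
by rewrite scalerA mulVf // scale1r.
Qed.

(** Equations with independent differentials are added as long as this is
    possible; there are at most n of them. *)
Lemma maximal_jacobian (g : 'rV[K]_n) : exists r (f : 'I_r -> {mpoly K[n]}),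
  [/\ forall i, vanishing_ideal W (f i), row_free (jacobian f g) &
    forall h, vanishing_ideal W h ->
      (\row_j h^`M(j).@[g 0] <= jacobian f g)%MS].
Proof.
apply: contrapT => H.
have big r : exists f : 'I_r -> {mpoly K[n]},
    (forall i, vanishing_ideal W (f i)) /\ row_free (jacobian f g).
  elim: r => [|r [f [If freef]]].
    by exists (fun=> 0); split=> [[]|] //; rewrite -row_leq_rank.
  have [h [Ih nh]] : exists h, vanishing_ideal W h /\
      ~~ (\row_j h^`M(j).@[g 0] <= jacobian f g)%MS.
    apply: contrapT => Hh; apply: H; exists r, f; split=> // h Ih.
    by apply: contrapT => /negP nh; apply: Hh; exists h.
  rewrite -addn1.
  exists (fun i => match split i with inl a => f a | inr _ => h end); split.
    by move=> i; case: (split i).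
  rewrite (_ : jacobian _ g = col_mx (jacobian f g) (\row_j h^`M(j).@[g 0])).
    exact: row_free_col_mx.
  apply/matrixP => i j; rewrite [LHS]mxE [RHS]mxE.
  by case: (split i) => a; rewrite !mxE.
have [f [_]] := big n.+1; rewrite /row_free => /eqP rk.
by have := rank_leq_col (jacobian f g); rewrite rk ltnn.
Qed.

Lemma tangent_jacobian r (f : 'I_r -> {mpoly K[n]}) g (v : 'rV_n) :
  (forall i, vanishing_ideal W (f i)) -> tangent_space W g v ->
  v *m (jacobian f g)^T = 0.
Proof.
move=> If Tv; apply/rowP => i; rewrite !mxE -[RHS](Tv _ (If i)).
by apply: eq_bigr => j _; rewrite !mxE mulrC.
Qed.

Lemma tangent_free_le r (f : 'I_r -> {mpoly K[n]}) g e (B : 'M_(e, n)) :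
  (forall i, vanishing_ideal W (f i)) -> row_free (jacobian f g) ->
  row_free B -> (forall i, tangent_space W g (row i B)) -> (e <= n - r)%N.
Proof.
move=> If /eqP rkJ /eqP rkB TB.
have : (B <= kermx (jacobian f g)^T)%MS.
  by apply/row_subP => i; apply/sub_kermxP; apply: tangent_jacobian.
by move=> /mxrankS; rewrite mxrank_ker mxrank_tr rkJ rkB.
Qed.

Lemma tangent_dim_maximal r (f : 'I_r -> {mpoly K[n]}) (g : 'rV[K]_n) d :
  (forall h, vanishing_ideal W h ->
      (\row_j h^`M(j).@[g 0] <= jacobian f g)%MS) ->
  row_free (jacobian f g) -> tangent_dim W g d -> (n - r <= d)%N.
Proof.
move=> maxf /eqP rkJ [B [/eqP rkB HB]].
have : (kermx (jacobian f g)^T <= B)%MS.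
  apply/row_subP => i; apply/HB => h Ih.
  have /submxP[c hE] := maxf h Ih.
  have /sub_kermxP : (row i (kermx (jacobian f g)^T) <= kermx (jacobian f g)^T)%MS.
    exact: row_sub.
  set v := row i _ => v0.
  have : v *m (\row_j h^`M(j).@[g 0])^T = 0.
    by rewrite hE trmx_mul mulmxA v0 mul0mx.
  move=> /rowP/(_ 0); rewrite !mxE => vh; rewrite -[RHS]vh.
  by apply: eq_bigr => j _; rewrite !mxE mulrC.
by move=> /mxrankS; rewrite mxrank_ker mxrank_tr rkJ rkB.
Qed.

(** The tangent space at the origin of the curve is the kernel of the jacobian
    of finitely many equations f with independent differentials. A determinant
    witnessing this independence is a polynomial in the parameter that is
    nonzero at 0; at any t where neither it nor bad vanishes the differentials
    of f are still independent, and bound the tangent space as they do at 0. *)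
Lemma tangent_semicontinuous (Phi : {poly {poly K}}) d (bad : {poly K}) :
  tangent_dim W (poly_rV Phi`_0) d -> bad != 0 ->
  exists2 t, bad.[t] != 0 & forall e (B : 'M_(e, n)), row_free B ->
    (forall i, tangent_space W (poly_rV Phi.[t%:P]) (row i B)) -> (e <= d)%N.
Proof.
set g := poly_rV _ => Td bad0.
have [r [f [If freef maxf]]] := maximal_jacobian g.
have [C CE] := row_freeP freef.
pose J : 'M[{poly K}]_(r, n) :=
  \matrix_(i < r, j < n) mmap polyC (curve_coord Phi) ((f i)^`M(j)).
pose D := \det (J *m map_mx polyC C).
have DE t : D.[t] = \det (jacobian f (poly_rV Phi.[t%:P]) *m C).
  rewrite /D -horner_evalE -det_map_mx map_mxM; congr (\det (_ *m _)).
    by apply/matrixP => i j; rewrite !mxE /= /horner_eval meval_curve.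
  by apply/matrixP => i j; rewrite !mxE /= /horner_eval hornerC.
have D0 : D != 0.
  apply/eqP => D0; have := DE 0; rewrite D0 horner0 polyC0 horner_coef0 -/g CE.
  by rewrite det1 => /esym/eqP; rewrite oner_eq0.
have [t] := exists_nonroot char0 (mulf_neq0 D0 bad0).
rewrite hornerM mulf_eq0 negb_or => /andP[Dt badt]; exists t => // e B freeB TB.
apply: leq_trans (tangent_dim_maximal maxf freef Td).
apply: tangent_free_le If _ freeB TB; apply/row_freeP.
exists (C *m invmx (jacobian f (poly_rV Phi.[t%:P]) *m C)).
by rewrite mulmxA mulmxV // unitmxE unitfE -DE.
Qed.

End Semicontinuity.

(** * The singular locus of Z_k *)

Section SingularLocus.
Variables (K : closedFieldType) (n : nat).
Hypothesis char0 : forall j : nat, j.+1%:R != 0 :> K.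

Lemma local_dim_le k (p : 'rV[K]_n) d : (k <= n)%N ->
  local_dim (Z K n k) p d -> (d <= k)%N.
Proof. by move=> kn [Cd _]; exact: chain_length_le Cd. Qed.

Lemma Z_mono k k' : (k <= k')%N -> Z K n k `<=` Z K n k'.
Proof. by move=> kk' g Zg s us rs; apply: leq_trans kk'; exact: Zg. Qed.

Lemma smooth_exact k (g : 'rV[K]_n) : (k <= n)%N ->
  Z K n k g -> (forall j, (j < k)%N -> ~ Z K n j g) ->
  smooth_point (Z K n k) g.
Proof.
move=> kn Zg nZ; split=> //; exists k.
have [l [s [m [si m0 sm E]]]] := exists_rprod_point g.
have lk : l = k.
  apply/eqP; rewrite eqn_leq; apply/andP; split.
    exact/(Z_distinct k si m0 E).
  rewrite leqNgt; apply/negP => lk; apply: (nZ l lk).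
  exact/(Z_distinct l si m0 E).
have gE : g = poly_rV (rprod l s m) by rewrite -E poly_rV_monic_poly_of.
rewrite gE -lk; split; first exact: tangent_dim_distinct.
split; first exact: chain_at_distinct.
by move=> e; apply: chain_length_le; rewrite ?lk.
Qed.

(** List the polynomial with k possibly equal roots and let the a-th root move
    at speed a: for all but finitely many values of the parameter the roots are
    then distinct. *)
Lemma singular_fewer_roots k (g : 'rV[K]_n) : (k.+1 < n)%N ->
  Z K n k g -> ~ smooth_point (Z K n k.+1) g.
Proof.
move=> kn Zg [_ [d [Td Ld]]].
have dk := local_dim_le (ltnW kn) Ld.
have [s [m [m0 sm E]]] := Z_param (ltnW (ltnW kn)) Zg.
pose Phi := moving_roots k s (fun a => a%:R) m.
have gE : g = poly_rV Phi`_0 by rewrite coef0_moving_roots -E poly_rV_monic_poly_of.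
pose bad : {poly K} := \prod_(a < k) \prod_(b < k | b != a)
  ((s a - s b)%:P + (a%:R - b%:R) *: 'X).
have bad0 : bad != 0.
  apply/prodf_neq0 => a _; apply/prodf_neq0 => b ba.
  apply/negP => /eqP/(congr1 (fun p : {poly K} => p`_1)).
  rewrite coefD coefC coefZ coefX coef0 mulr1 add0r => /eqP.
  by rewrite subr_eq0 (inj_eq (natr_inj0 char0)) eq_sym -[_ == _]/(b == a) (negbTE ba).
rewrite gE in Td.
have [t badt HB] := tangent_semicontinuous char0 Td bad0.
pose st a := s a + t * a%:R.
have st_inj : injective (fun a : 'I_k => st a).
  move=> a b ab; apply/eqP; rewrite eq_sym; apply: contraNT badt => ba.
  rewrite /bad horner_prod (bigD1 a) //= horner_prod (bigD1 b) //=.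
  rewrite hornerD hornerC hornerZ hornerX.
  suff -> : s a - s b + (a%:R - b%:R) * t = st a - st b.
    by rewrite ab subrr !mul0r.
  by rewrite /st; ring.
have [B [freeB TB]] := extra_tangents char0 st_inj m0 sm kn (ltnSn k).
rewrite /Phi horner_moving_roots in HB.
have := HB _ B freeB TB; rewrite addn2 => kd.
by have := leq_trans kd dk; rewrite ltnn.
Qed.

Theorem Sing_Z k : (k.+1 < n)%N -> Sing (Z K n k.+1) = Z K n k.
Proof.
move=> kn; apply/seteqP; split=> g; last first.
  by move=> Zg; split; [exact: Z_mono Zg|exact: singular_fewer_roots].
move=> [Zg nsm]; apply: contrapT => nZ; apply: nsm; apply: smooth_exact => //.
  exact: ltnW.
by move=> j; rewrite ltnS => jk Zj; apply: nZ; exact: Z_mono Zj.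
Qed.

Lemma Z0_empty : (0 < n)%N -> Z K n 0 = set0.
Proof.
move=> n0; apply/seteqP; split=> // g Zg.
have /closed_rootP[z rz] : size (monic_poly_of (g 0)) != 1%N.
  by rewrite size_monic_poly_of eqSS -lt0n.
by have := Zg [:: z] isT; rewrite /= rz => /(_ isT).
Qed.

Lemma Sing_Z1 : (0 < n)%N -> Sing (Z K n 1) = set0.
Proof.
move=> n0; apply/seteqP; split=> // g [Zg nsm]; apply: nsm.
apply: smooth_exact => // j; rewrite ltnS leqn0 => /eqP ->.
by rewrite Z0_empty.
Qed.

(** A polynomial with the roots 0, ..., k' - 1, where 0 takes the remaining
    multiplicity. *)
Lemma Z_proper k k' : (k < k')%N -> (k' <= n)%N -> Z K n k `<` Z K n k'.
Proof.
move=> kk' kn; split; first exact/Z_mono/ltnW.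
have [s [m [si m0 sm]]] : exists (s : nat -> K) m,
  [/\ injective (fun a : 'I_k' => s a), forall a, (a < k')%N -> (0 < m a)%N
    & (\sum_(a < k') m a = n)%N].
  exists (fun a => a%:R), (fun a => (if a == 0 then n - k'.-1 else 1)%N).
  case: k' kk' kn => // k' _ kn; split.
  - by move=> a b /(natr_inj0 char0)/val_inj.
  - by move=> [|a] //= _; rewrite subn_gt0.
  - rewrite big_ord_recl /= (eq_bigr (fun=> 1%N)) // sum1_card card_ord.
    by rewrite subnK // ltnW.
move=> /(_ (poly_rV (rprod k' s m))).
have E := point_rprod s sm.
move=> /(_ (in_Z E (leqnn k'))) /(Z_distinct k si m0 E).
by rewrite leqNgt kk'.
Qed.

End SingularLocus.

(** * The discriminant hypersurface *)

(** The dimension of the Sylvester matrix depends on the degrees, whence the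
    assumption that they do not drop. *)
Lemma rmorph_resultant (A B : comNzRingType) (f : {rmorphism A -> B})
    (p q : {poly A}) :
  size (map_poly f p) = size p -> size (map_poly f q) = size q ->
  f (resultant p q) = resultant (map_poly f p) (map_poly f q).
Proof.
move=> sp sq; rewrite /resultant /Sylvester_mx -det_map_mx map_col_mx sp sq.
congr (\det (col_mx _ _)); apply/matrixP => i j;
  by rewrite !mxE /= -coef_map rmorphM /= map_rVpoly map_delta_mx.
Qed.

Section DiscriminantLocus.
Variables (K : closedFieldType) (n : nat).
Hypothesis char0 : forall j : nat, j.+1%:R != 0 :> K.
Hypothesis n_gt0 : (0 < n)%N.

Lemma size_deriv_monic_poly_of (A : comNzRingType) (c : 'I_n -> A) :
  n%:R != 0 :> A -> size (monic_poly_of c)^`() = n.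
Proof.
move=> n0; apply/eqP; rewrite eqn_leq; apply/andP; split.
  have := @lt_size_deriv _ (monic_poly_of c).
  by rewrite -size_poly_eq0 size_monic_poly_of; apply.
rewrite -{1}(prednK n_gt0) ltnNge; apply: contra n0 => /leq_sizeP.
move=> /(_ _ (leqnn _)); rewrite coef_deriv prednK // coefD coefXn eqxx.
rewrite coef_sum big1 ?addr0 => [->//|i _].
by rewrite coefZ coefXn gtn_eqF // mulr0.
Qed.

Lemma VD_common_root (g : 'rV[K]_n) : VD K n g <->
  exists z, root (monic_poly_of (g 0)) z && root (monic_poly_of (g 0))^`() z.
Proof.
have nK : n%:R != 0 :> K by rewrite -(prednK n_gt0).
have nM : n%:R != 0 :> {mpoly K[n]}.
  by rewrite -mpolyC_nat mpolyC_eq0.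
have mapE : map_poly (meval (g 0)) (generic_poly K n) = monic_poly_of (g 0).
  rewrite map_generic_poly /monic_poly_of; congr (_ + _).
  by apply: eq_bigr => i _; congr (_ *: _); exact: mevalXU.
have dE : (discriminant K n).@[g 0] = (-1) ^+ (n * n.-1)./2 *
    resultant (monic_poly_of (g 0)) (monic_poly_of (g 0))^`().
  rewrite /discriminant mevalM rmorph_sign rmorph_resultant.
  - by rewrite -deriv_map mapE.
  - by rewrite mapE !size_monic_poly_of.
  - by rewrite -deriv_map mapE !size_deriv_monic_poly_of.
have -> : VD K n g <-> (discriminant K n).@[g 0] = 0.
  by split=> [H|H f ->//]; exact: H.
rewrite dE; set p := monic_poly_of (g 0).
have p0 : p != 0 by rewrite monic_neq0 // monic_poly_of_monic.
split=> [/eqP|[z rz]].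
  rewrite mulf_eq0 signr_eq0 /= resultant_eq0 => sz.
  have /closed_rootP[z] : size (gcdp p p^`()) != 1%N by rewrite gtn_eqF.
  by rewrite root_gcd; exists z.
apply/eqP; rewrite mulf_eq0 signr_eq0 /= resultant_eq0.
by apply: (@root_size_gt1 _ z); rewrite ?gcdp_eq0 ?(negbTE p0) // root_gcd.
Qed.

(** A common root of F and F' is a root of gcd(F, F'), that is a multiple root,
    and one exists exactly when there are fewer than n distinct roots. *)
Lemma Z_VD : Z K n (n - 1) = VD K n.
Proof.
rewrite subn1; apply/predeqP => g; rewrite VD_common_root.
have [l [s [m [si m0 sm E]]]] := exists_rprod_point g.
rewrite (Z_distinct _ si m0 E) E deriv_rprod // -ltnS prednK //.
have ln : (l < n)%N <-> exists a : 'I_l, (1 < m a)%N.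
  split=> [ln|[a ma]].
    have [|a _ ma] := @exists_gt1 'I_l predT (fun a => m a); last by exists a.
    by rewrite sum1_card card_ord sm.
  rewrite -sm -[ltnLHS]card_ord -sum1_card (bigD1 a) //= [ltnRHS](bigD1 a) //=.
  rewrite -addSn; apply: leq_add => //.
  by apply: leq_sum => b _; exact: m0.
rewrite ln; split=> [[a ma]|[z /andP[rz]]].
  exists (s a); rewrite rprod_root ?m0 //= rootM /rgcd.
  by rewrite rprod_root // -subn1 subn_gt0.
have [a ->] := root_rprod rz; rewrite rootM.
rewrite {2}/root (negbTE (horner_logder_neq0 char0 si m0 a)) orbF.
rewrite /root horner_prod => /prodf_eq0[b _].
rewrite horner_exp expf_eq0 => /andP[mb _]; exists b.
by rewrite -subn1 subn_gt0 in mb.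
Qed.

End DiscriminantLocus.

Theorem theorem12 (R : realType) (n : nat) (hn : (1 <= n)%N) :
  [/\ forall k : nat, (2 <= k <= n - 1)%N ->
        Sing (Z R[i] n k) = Z R[i] n (k - 1),
      forall k : nat, (1 <= k <= n - 1)%N ->
        Z R[i] n k = iter (n - 1 - k) (@Sing R[i] n) (VD R[i] n)
    & [/\ Z R[i] n (n - 1) = VD R[i] n,
          forall k : nat, (1 <= k)%N -> (k < n - 1)%N ->
            Z R[i] n k `<` Z R[i] n k.+1,
          Sing (Z R[i] n 1) = set0
        & smoothness_stratification (VD R[i] n)
            [seq Z R[i] n k | k <- rev (iota 1 (n - 1))]]].
Proof.
have char0 (j : nat) : j.+1%:R != 0 :> R[i] by rewrite Num.Theory.pnatr_eq0.
have SingS k : (k.+1 <= n - 1)%N -> Sing (Z R[i] n k.+1) = Z R[i] n k.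
  by move=> kn; apply: Sing_Z => //; rewrite -[n](subnK hn) addn1 ltnS.
have ltn1 k : (k < n - 1)%N -> (k.+1 <= n)%N.
  by move=> kn; rewrite (leq_trans kn) // leq_subr.
split.
- by case=> [//|k] /andP[_ kn]; rewrite subn1 SingS.
- move=> k /andP[k1 kn]; rewrite -(Z_VD char0 hn) -{1}(subKn kn).
  elim: (n - 1 - k)%N (leq_subr k (n - 1)) => [|j IH] jn; first by rewrite subn0.
  rewrite iterS -IH ?(ltnW jn) // -(SingS (n - 1 - j.+1)%N).
    by rewrite subnSK.
  by rewrite subnSK // leq_subr.
- split.
  + exact: Z_VD.
  + by move=> k _ kn; apply: Z_proper => //; exact: ltn1.
  + exact: Sing_Z1.
  + rewrite -(Z_VD char0 hn).
    suff strat j : (j <= n - 1)%N -> smoothness_stratification (Z R[i] n j)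
        [seq Z R[i] n k | k <- rev (iota 1 j)] by exact: strat.
    elim: j => [|j IH] jn; first exact: Z0_empty.
    rewrite -{2}[j.+1]addn1 iotaD rev_cat map_cat /= add1n; split=> //.
      by rewrite SingS //; exact: (Z_proper char0 (ltnSn j) (ltn1 _ jn)).
    by rewrite SingS //; apply: IH; exact: ltnW.
Qed.
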